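(* Let $T>0$, let $\varphi:\mathbb{R}\to\mathbb{R}$ be a homeomorphism with $\varphi(0)=0$, and let $f:[0,T]\times\mathbb{R}\times\mathbb{R}\to\mathbb{R}$ be continuous. Assume: (i) there exists $c\in C([0,T],\mathbb{R})$ such that $f(t,x,y)\ge c(t)$ for all $(t,x,y)\in[0,T]\times\mathbb{R}\times\mathbb{R}$; (ii) there exist real numbers $M_{1}<M_{2}$ such that for all $u\in C^{1}$, \[ \int_0^T f(t,u(t),u'(t))\,dt\neq0\ \text{ if }\ \min_{[0,T]}u'\ge M_{2},\qquad \int_0^T f(t,u(t),u'(t))\,dt\neq0\ \text{ if }\ \max_{[0,T]}u'\le M_{1}. \] Put $L=\max\{|\varphi(M_{2})|,|\varphi(M_{1})|\}$ and \[ r=\max\big\{|\varphi^{-1}(L+2\|c^{-}\|_{L^{1}})|,\ |\varphi^{-1}(-L-2\|c^{-}\|_{L^{1}})|\big\}. \] Define $G:\mathbb{R}^{2}\to\mathbb{R}^{2}$ by \[ G(a,b)=\Big(aT+bT^{2}-bT-\frac1T\int_0^T f(t,a+bt,b)\,dt,\; b-a-bT\Big), \] and assume that for some $\rho\ge r(2+T)$ the following conditions hold: 1. the equation $G(a,b)=(0,0)$ has no solution on $\partial B_{\rho}(0)\cap\mathbb{R}^{2}$; 2. the Brouwer degree satisfies $\deg_{B}(G,B_{\rho}(0)\cap\mathbb{R}^{2},0)\neq0$. Then the problem \[ (\varphi(u'))'=f(t,u,u'),\qquad u(T)=u'(0)=u'(T), \] has a solution.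
   Context: $C^{1}=C^{1}([0,T],\mathbb{R})$ is the Banach space of continuously differentiable functions with norm $\|u\|_{1}=\|u\|_{\infty}+\|u'\|_{\infty}$, and $B_{\rho}(0)$ is the open ball in $C^{1}$ with center $0$ and radius $\rho$. The space $\mathbb{R}^{2}$ is identified with the subspace of affine functions in $C^{1}$ via $(a,b)\approx(t\mapsto a+bt)$; intersections with $\mathbb{R}^{2}$ are understood through this identification. $c^{-}=\max\{-c,0\}$ and $\|c^{-}\|_{L^{1}}=\int_0^T c^{-}(t)\,dt$. A solution of the problem is a function $u:[0,T]\to\mathbb{R}$ of class $C^{1}$ such that $\varphi(u')$ is continuously differentiable, $(\varphi(u'(t)))'=f(t,u(t),u'(t))$ for all $t\in[0,T]$, and $u(T)=u'(0)=u'(T)$. $\deg_B$ denotes the Brouwer degree. *)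

(* Defs.v *)
From HB Require Import structures.
From mathcomp Require Export all_boot all_order all_algebra.
From mathcomp Require Export all_classical all_reals all_analysis.
Export Order.TTheory GRing.Theory Num.Theory.
Export numFieldNormedType.Exports.

Set Implicit Arguments.
Unset Strict Implicit.
Unset Printing Implicit Defensive.

Local Open Scope classical_set_scope.
Local Open Scope ring_scope.

Definition homeomorphism (X Y : topologicalType) (f : X -> Y) (g : Y -> X) :=
  [/\ cancel f g, cancel g f, continuous f & continuous g].

(* Functions on [0, T] are represented by total functions R -> R whose values
   outside [0, T] are irrelevant.  The difference quotient is therefore taken
   inside A only, which gives one-sided derivatives at the ends of A = [a, b]
   (a < b). *)
Section C1.
Context {R : realType}.
Implicit Types (A : set R) (u : R -> R) (t : R).

Definition diff_quotient u t (s : R) : R := (u s - u t) / (s - t).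

Definition derivable_on A u :=
  forall t, A t -> cvg (diff_quotient u t @ within A t^').

Definition derive_on A u t : R := lim (diff_quotient u t @ within A t^').

Definition C1_on A u :=
  derivable_on A u /\ {within A, continuous (derive_on A u)}.

Definition sup_norm A u : R := sup [set `|u t| | t in A].

Definition C1_norm A u : R := sup_norm A u + sup_norm A (derive_on A u).

End C1.

(* Brouwer degree of f : closure U -> R^n at y, for U open and bounded, f
   continuous on closure U and y outside f(boundary of U): the common value of
   the sums of sgn (det J_g(x)) over x in U with g x = y, for g continuous on
   closure U, C^1 in U, having y as a regular value and satisfying
   |g - f| < dist(y, f(boundary of U)) uniformly on closure U.
   Matrices act on row vectors in 'J, which does not affect the determinant. *)
Section Brouwer_degree.
Context {R : realType} {n : nat}.
Implicit Types (U : set 'rV[R]_n) (f g : 'rV[R]_n -> 'rV[R]_n) (y : 'rV[R]_n).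

(* The strict uniform bound is given with an explicit d at most
   dist(y, f(boundary of U)); it is unsatisfiable when y is in
   f(boundary of U). *)
Definition degree_close U f y g :=
  exists d : R,
    (forall x, (closure U `\` U) x -> d <= `|f x - y|) /\
    (forall x, closure U x -> `|g x - f x| < d).

Definition regular_value U g y :=
  forall x, U x -> g x = y -> \det ('J g x) != 0.

Definition degree_approx U f y g :=
  [/\ {within closure U, continuous g},
      forall x, U x -> differentiable g x,
      {within U, continuous (jacobian g)},
      regular_value U g y &
      degree_close U f y g].

Definition signed_count U g y : int :=
  \sum_(x \in U `&` g @^-1` [set y]) sgz (\det ('J g x)).

Definition is_brouwer_degree U f y (d : int) :=
  (exists g, degree_approx U f y g) /\
  (forall g, degree_approx U f y g -> signed_count U g y = d).

Definition brouwer_degree U f y : int := xget 0 (is_brouwer_degree U f y).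

End Brouwer_degree.

Section problem.
Context {R : realType}.
Implicit Types (T a b rho : R) (f : R -> R -> R -> R) (phi u : R -> R).

Definition nonlin_integral T f u : R :=
  \int[lebesgue_measure]_(t in `[0, T]) f t (u t) (derive_on `[0, T] u t).

Definition affine (v : 'rV[R]_2) (t : R) : R := v 0 0 + v 0 1 * t.

Definition affine_ball T rho : set 'rV[R]_2 :=
  [set v | C1_norm `[0, T] (affine v) < rho].

Definition affine_sphere T rho : set 'rV[R]_2 :=
  [set v | C1_norm `[0, T] (affine v) = rho].

Definition G_map T f (v : 'rV[R]_2) : 'rV[R]_2 :=
  let a := v 0 0 in let b := v 0 1 in
  \row_(i < 2)
    if i == 0 then
      a * T + b * T ^+ 2 - b * T
      - T^-1 * \int[lebesgue_measure]_(t in `[0, T]) f t (a + b * t) b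
    else b - a - b * T.

Definition is_solution T phi f u :=
  let du := derive_on `[0, T] u in
  [/\ C1_on `[0, T] u,
      C1_on `[0, T] (phi \o du),
      forall t, t \in `[0, T] ->
        derive_on `[0, T] (phi \o du) t = f t (u t) (du t),
      u T = du 0 &
      du 0 = du T].

End problem.

(* Main.v *)
Require Import Defs.
From mathcomp Require Import ring lra.

(** Integrating, (u, u') is recovered from w = u' by u(t) = b - int_t^T w with
    b = u(T), and the boundary conditions say that w(T) = w(0) = b, that is
    phi(w(t)) = phi(b) - int_t^T f(s, u, w) ds and Phi(b, w) = 0, where
    Phi(b, w) = int_0^T f(s, u, w) ds.

    By (ii) and convexity, Phi has a constant sign on {w >= M2} and a constant
    sign on {w <= M1}.  The degree hypothesis is only used to see that these two
    signs are opposite: G vanishes only on the line a = b (1 - T), where it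
    reduces to b |-> Phi(b, cst b), and if this function had the same sign at
    both ends of the ball then a polynomial approximation of G with simple zeros
    would have signed count 0, so that the degree would be 0.

    For the existence part put K = ||c^-||_1 and shoot backwards from
    u(T) = u'(T) = b, truncating int_t^T f to [-K, K].  With a delay in the
    integral the trajectory is unique and depends continuously on b.  For suitable
    b it satisfies w >= M2, for others w <= M1, so the intermediate value theorem
    gives b with Phi = 0; an ultrafilter limit (all trajectories are
    equi-Lipschitz) removes the delay, and f >= c together with Phi = 0 makes the
    truncation inactive. *)
Set Implicit Arguments.
Unset Strict Implicit.
Unset Printing Implicit Defensive.

Local Open Scope classical_set_scope.
Local Open Scope ring_scope.

(** * Truncation of a real number to an interval *)

Definition clamp {R : realType} (a b x : R) : R := Num.max a (Num.min b x).

Lemma clamp_itv {R : realType} (a b x : R) : a <= b -> a <= clamp a b x <= b.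
Proof. by move=> ab; rewrite /clamp le_max lexx ge_max ab ge_min lexx. Qed.

Lemma clamp_id {R : realType} (a b x : R) : a <= x <= b -> clamp a b x = x.
Proof. by move=> /andP[ax xb]; rewrite /clamp (min_idPr xb) (max_idPr ax). Qed.

Lemma clamp_lipschitz {R : realType} (a b x y : R) :
  `|clamp a b x - clamp a b y| <= `|x - y|.
Proof.
wlog xy : x y / x <= y.
  move=> H; case: (leP x y) => [/H//|/ltW/H].
  by rewrite distrC (distrC y).
rewrite [in leRHS]ler0_norm ?subr_le0// ler_norml opprB /clamp !maxEle !minEle.
by repeat case: ifPn; rewrite -?ltNge => *; apply/andP; split; lra.
Qed.

Lemma continuous_clamp {R : realType} (a b : R) : continuous (clamp a b).
Proof.
move=> x; apply/cvgrPdist_le => e e0.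
have /cvgrPdist_le/(_ e e0) : id y @[y --> x] --> x by exact: cvg_id.
by apply: filterS => y; apply: le_trans; exact: clamp_lipschitz.
Qed.

(** * Primitives vanishing at the right end *)

Section tail_integral.
Context {R : realType}.
Notation mu := (@lebesgue_measure R).
Implicit Types (g w : R -> R) (a b s t T M e : R).

Lemma continuous_integrable a b g : continuous g ->
  mu.-integrable `[a, b] (EFin \o g).
Proof.
move=> cg; apply: continuous_compact_integrable; first exact: segment_compact.
exact: continuous_subspaceT.
Qed.

Lemma Rintegral_cst_itv a b M : a <= b -> \int[mu]_(x in `[a, b]) M = M * (b - a).
Proof.
move=> ab; rewrite Rintegral_cst//= lebesgue_measure_itv/= lte_fin.
by case: ltgtP ab => //= -> _; rewrite subrr.
Qed.

Lemma le_normr_Rintegral_itv a b g M : continuous g -> a <= b ->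
  (forall x, a <= x <= b -> `|g x| <= M) ->
  `|\int[mu]_(x in `[a, b]) g x| <= M * (b - a).
Proof.
move=> cg ab gM.
apply: le_trans.
  by apply: le_normr_Rintegral => //; exact: continuous_integrable.
have cng : continuous (fun x => `|g x|).
  by move=> x; apply: continuous_comp; [exact: cg|exact: norm_continuous].
rewrite -Rintegral_cst_itv//; apply: le_Rintegral => //.
- exact: continuous_integrable.
- by apply: continuous_integrable; exact: cst_continuous.
Qed.

(** For t > T the interval is empty and the value is 0, so delayed arguments t + h beyond T need no
    separate definition. *)
Definition tail T g t : R := \int[mu]_(s in `[t, T]) g s.

Lemma tail_ge T g t : T <= t -> tail T g t = 0.
Proof.
rewrite /tail le_eqVlt => /predU1P[<-|Tt].
  by rewrite set_itv1 Rintegral_set1.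
by rewrite set_itv_ge ?Rintegral_set0// bnd_simp -ltNge.
Qed.

Lemma tail_split T g s t : continuous g -> s <= t -> t <= T ->
  tail T g s = \int[mu]_(x in `[s, t]) g x + tail T g t.
Proof.
move=> cg st tT; rewrite /tail.
have := @Rintegral_itvB R g (BLeft s) (BRight T) t (continuous_integrable _ _ cg).
rewrite !bnd_simp => /(_ st tT); rewrite Rintegral_itv_obnd_cbnd; last first.
  apply: integrableS (continuous_integrable t T cg) => //.
  by apply: subset_itvr; rewrite bnd_simp.
by move=> <-; rewrite addrC subrK.
Qed.

(** The tail is 0 past T, so a bound on g up to min(t, T) suffices; this covers a delayed endpoint t
    > T. *)
Lemma tail_lipschitz T g s t M : continuous g -> 0 <= M -> s <= t ->
  (forall x, s <= x <= Num.min t T -> `|g x| <= M) ->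
  `|tail T g s - tail T g t| <= M * (t - s).
Proof.
move=> cg M0 st gM; have [Ts|sT] := leP T s.
  by rewrite !tail_ge ?(le_trans Ts)// subrr normr0 mulr_ge0 ?subr_ge0.
have smin : s <= Num.min t T by rewrite le_min st ltW.
rewrite (tail_split cg smin) ?ge_min ?lexx ?orbT//.
have -> : tail T g (Num.min t T) = tail T g t.
  by have [//|Tt] := leP t T; rewrite !tail_ge// ltW.
rewrite addrK; apply: (le_trans (le_normr_Rintegral_itv cg smin gM)).
by rewrite ler_wpM2l// lerB// ge_min lexx.
Qed.

(** Near t the integrand is bounded by |g(t)| + 1, hence the tail is locally Lipschitz. *)
Lemma continuous_tail T g : continuous g -> continuous (tail T g).
Proof.
move=> cg t; apply/cvgrPdist_le => e e0.
have M0 : 0 < `|g t| + 1 by rewrite ltr_wpDl.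
have /cvgrPdist_le/(_ 1 ltr01) [d/= d0 gd] : g x @[x --> t] --> g t by exact: cg.
have gM x : `|t - x| < d -> `|g x| <= `|g t| + 1.
  move=> /gd /= h; rewrite -lerBlDl; apply: le_trans h.
  by rewrite distrC; exact: lerB_dist.
have key x y : x <= y -> `|t - x| < d -> `|t - y| < d ->
    `|tail T g x - tail T g y| <= (`|g t| + 1) * (y - x).
  move=> xy xd yd; apply: tail_lipschitz (ltW M0) xy _ => //.
  move=> z; rewrite le_min => /and3P[xz zy _]; apply: gM.
  move: xd yd; rewrite !ltr_norml => /andP[? ?] /andP[? ?].
  by apply/andP; split; lra.
near=> x.
have xd : `|t - x| < d by near: x; apply: cvgr_dist_lt => //; exact: cvg_id.
have xe : `|t - x| <= e / (`|g t| + 1).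
  by near: x; apply: cvgr_dist_le; [exact: cvg_id|rewrite divr_gt0].
rewrite ler_pdivlMr// mulrC in xe.
have td : `|t - t| < d by rewrite subrr normr0.
have [tx|/ltW xt] := leP t x.
  apply: (le_trans (key _ _ tx td xd)); apply: le_trans xe.
  by rewrite ler_pM2l// distrC ler_norm.
rewrite distrC; apply: (le_trans (key _ _ xt xd td)); apply: le_trans xe.
by rewrite ler_pM2l// ler_norm.
Unshelve. all: by end_near. Qed.

Definition prim T b w t : R := b - tail T w t.

Lemma continuous_prim T b w : continuous w -> continuous (prim T b w).
Proof.
move=> cw t; apply: cvgB; first exact: cvg_cst.
exact: continuous_tail.
Qed.

Lemma prim_diff T b w s t : continuous w -> s <= t -> t <= T ->
  prim T b w t - prim T b w s = \int[mu]_(x in `[s, t]) w x.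
Proof. by move=> cw st tT; rewrite /prim (@tail_split T w s t)//; ring. Qed.

End tail_integral.

(** * Derivatives of primitives within [0, T] *)

Section tail_more.
Context {R : realType}.
Notation mu := (@lebesgue_measure R).
Implicit Types (g w : R -> R) (a b s t T M e : R).

Lemma RintegralB_itv a b g w : continuous g -> continuous w ->
  \int[mu]_(x in `[a, b]) (g x - w x) =
  \int[mu]_(x in `[a, b]) g x - \int[mu]_(x in `[a, b]) w x.
Proof. by move=> cg cw; apply: RintegralB => //; exact: continuous_integrable. Qed.

Lemma continuousB_fun g w : continuous g -> continuous w ->
  continuous (fun x => g x - w x).
Proof. by move=> cg cw x; apply: cvgB; [exact: cg|exact: cw]. Qed.

(** The increment minus w(t)(s - t) is the integral of w - w(t) between s and t, at most e |s - t|
    in absolute value once s is close to t. *)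
Lemma prim_diff_quotient T b w t : continuous w -> 0 <= t <= T ->
  diff_quotient (prim T b w) t @ within `[0, T] t^' --> w t.
Proof.
move=> cw t0T; apply/cvgrPdist_le => e e0.
have /cvgrPdist_le/(_ e e0)/nbhs_ballP[d /= d0 wd] : w x @[x --> t] --> w t.
  exact: cw.
have key x y : 0 <= x <= y -> y <= T -> ball t d x -> ball t d y ->
    `|prim T b w y - prim T b w x - w t * (y - x)| <= e * (y - x).
  move=> /andP[x0 xy] yT tx ty; rewrite prim_diff// -Rintegral_cst_itv//.
  rewrite -RintegralB_itv//; last exact: cst_continuous.
  apply: le_normr_Rintegral_itv => //.
    by apply: continuousB_fun => //; exact: cst_continuous.
  move=> z /andP[xz zy]; rewrite distrC; apply: wd.
  move: tx ty; rewrite /ball/= !ltr_norml => /andP[? ?] /andP[? ?].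
  by apply/andP; split; lra.
apply/nbhs_ballP; exists d => //= s tsd snt; rewrite in_itv/= => /andP[s0 sT].
have ts0 : s - t != 0 by rewrite subr_eq0.
have /andP[t0 tT] := t0T.
have tt : ball t d t by exact: ballxx.
rewrite distrC /diff_quotient.
have -> : (prim T b w s - prim T b w t) / (s - t) - w t =
  (prim T b w s - prim T b w t - w t * (s - t)) / (s - t) by field.
rewrite normrM normfV ler_pdivrMr ?normr_gt0//.
have [ts|/ltW st] := leP t s.
  by rewrite (@ger0_norm _ (s - t)) ?subr_ge0//; apply: key => //; rewrite t0.
rewrite (@ler0_norm _ (s - t)) ?subr_le0// (_ : - (s - t) = t - s); last by ring.
have -> : prim T b w s - prim T b w t - w t * (s - t) =
  - (prim T b w t - prim T b w s - w t * (t - s)) by ring.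
by rewrite normrN; apply: key => //; rewrite s0.
Qed.

(** Properness makes limits unique, so that [derive_on] can be computed from a convergence. Nearby
    points are found on the right of t if t < T and on the left if t = T. *)
Lemma within_dnbhs_proper T t : 0 < T -> 0 <= t <= T ->
  ProperFilter (within `[0, T] t^').
Proof.
move=> T0 /andP[t0 tT]; apply: Build_ProperFilter_ex => B.
move=> /nbhs_ballP[d /= d0 dB].
have [tltT|Tt] := ltP t T.
- exists (Num.min T (t + d / 2)).
  have ? : t < Num.min T (t + d / 2) by rewrite lt_min tltT/=; lra.
  have ? : Num.min T (t + d / 2) <= t + d / 2 by rewrite ge_min lexx orbT.
  apply: dB => /=.
  + by rewrite /ball/= ltr_norml; apply/andP; split; lra.
  + by rewrite gt_eqF.
  + by rewrite in_itv/= ge_min lexx andbT; lra.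
- exists (Num.max 0 (t - d / 2)).
  have ? : Num.max 0 (t - d / 2) < t by rewrite gt_max; apply/andP; split; lra.
  have ? : t - d / 2 <= Num.max 0 (t - d / 2) by rewrite le_max lexx orbT.
  apply: dB => /=.
  + by rewrite /ball/= ltr_norml; apply/andP; split; lra.
  + by rewrite lt_eqF.
  + by rewrite in_itv/= le_max lexx/=; lra.
Qed.

Lemma diff_quotient_eq (A : set R) (u v : R -> R) t (l : R) :
  A t -> {in A, u =1 v} ->
  diff_quotient u t @ within A t^' --> l ->
  diff_quotient v t @ within A t^' --> l.
Proof.
move=> At uv; apply: cvg_trans; apply: near_eq_cvg.
near=> s; have As : A s by near: s; exact: withinT.
by rewrite /diff_quotient !uv// inE.
Unshelve. all: by end_near. Qed.

(** All regularity claims go through this lemma: it is applied to primitives, to affine functions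
    and to phi(u'). Only the values of u on [0, T] are prescribed. *)
Lemma prim_C1 T b w u : 0 < T -> continuous w ->
  {in `[0, T]%classic, u =1 prim T b w} ->
  C1_on `[0, T] u /\ {in `[0, T], derive_on `[0, T] u =1 w}.
Proof.
move=> T0 cw uE.
have cvgu t : 0 <= t <= T -> diff_quotient u t @ within `[0, T] t^' --> w t.
  move=> t0T; apply: diff_quotient_eq (prim_diff_quotient b cw t0T).
    by rewrite /= in_itv.
  by move=> s sA; rewrite uE.
have dE : {in `[0, T], derive_on `[0, T] u =1 w}.
  move=> t; rewrite in_itv/= => t0T; apply: cvg_lim; first exact: Rhausdorff.
    exact: within_dnbhs_proper.
  exact: cvgu.
split=> //; split.
  by move=> t /=; rewrite in_itv/= => t0T; apply/cvg_ex; exists (w t); exact: cvgu.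
apply: (@subspace_eq_continuous _ _ _ w); last exact: continuous_subspaceT.
by move=> t; rewrite inE /= => /dE.
Qed.

End tail_more.

(** * Uniform convergence along a filter *)

Section uniform_convergence.
Context {R : realType} {I : Type} (F : set_system I) {FF : Filter F}.
Implicit Types (T e h : R).

(** The filter is arbitrary because two kinds of limits occur: neighbourhood filters for continuity
    in parameters, and an ultrafilter on the integers for the vanishing delay. *)
Definition ucvg T (g : I -> R -> R) (g0 : R -> R) := forall e, 0 < e ->
  \forall n \near F, forall t, 0 <= t <= T -> `|g n t - g0 t| <= e.

Lemma ucvg_at T g g0 t : ucvg T g g0 -> 0 <= t <= T ->
  g n t @[n --> F] --> g0 t.
Proof.
move=> gg0 tT; apply/cvgrPdist_le => e e0; apply: filterS (gg0 e e0) => n h.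
by rewrite distrC; exact: h.
Qed.

Lemma ucvg_tail T (g : I -> R -> R) (g0 : R -> R) h : 0 <= T -> 0 <= h ->
  (forall n, continuous (g n)) -> continuous g0 -> ucvg T g g0 ->
  ucvg T (fun n t => tail T (g n) (t + h)) (fun t => tail T g0 (t + h)).
Proof.
move=> T0 h0 cg cg0 gg0 e e0.
have T1 : 0 < T + 1 by lra.
apply: filterS (gg0 (e / (T + 1)) (divr_gt0 e0 T1)) => n gn t /andP[t0 tT].
have [Tth|thT] := leP T (t + h); first by rewrite !tail_ge// subrr normr0 ltW.
rewrite /tail -RintegralB_itv//; apply: le_trans.
  apply: le_normr_Rintegral_itv; [exact: continuousB_fun|exact: ltW|].
  by move=> x /andP[tx xT]; apply: gn; rewrite xT andbT; lra.
rewrite -mulrA ler_piMr ?(ltW e0)// mulrC ler_pdivrMr//; lra.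
Qed.

Lemma ucvg_prim T (b : I -> R) (b0 : R) (w : I -> R -> R) (w0 : R -> R) : 0 <= T ->
  (forall n, continuous (w n)) -> continuous w0 ->
  b n @[n --> F] --> b0 -> ucvg T w w0 ->
  ucvg T (fun n => prim T (b n) (w n)) (prim T b0 w0).
Proof.
move=> T0 cw cw0 bb0 ww0 e e0; have e20 : 0 < e / 2 by lra.
have := ucvg_tail T0 (lexx 0) cw cw0 ww0 e20.
move/cvgrPdist_le : bb0 => /(_ _ e20); apply: filterS2 => n h1 h2 t /h2.
rewrite addr0 /prim => {}h2.
have -> : b n - tail T (w n) t - (b0 - tail T w0 t) =
  (b n - b0) - (tail T (w n) t - tail T w0 t) by ring.
by apply: (le_trans (ler_normB _ _)); rewrite distrC in h1; lra.
Qed.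

End uniform_convergence.

(** Heine-Cantor around K: only x lies in K, while y may leave it, as the values of functions
    approximating a limit with image K do. *)
Lemma compact_unif_nbhs {R : realType} {V : pseudoMetricType R} (K : set V)
    (F : V -> R) (e : R) : compact K -> continuous F -> 0 < e ->
  exists2 d, 0 < d & forall x y, K x -> ball x d y -> `|F y - F x| <= e.
Proof.
move=> /compact_near_coveringP cK cF e0.
have e20 : 0 < e / 2 by lra.
have : \forall d \near 0^'+,
    K `<=` [set x | forall y, ball x d y -> `|F y - F x| <= e].
  apply: cK => x Kx.
  have /cvgrPdist_le/(_ _ e20)/nbhs_ballP[r /= r0 xr] : F y @[y --> x] --> F x.
    exact: cF.
  have r20 : 0 < r / 2 by lra.
  exists (ball x (r / 2), [set d | d <= r / 2]) => /=.
    by split; [exact: nbhsx_ballx|exact: nbhs_right_le].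
  move=> [x' d]/= [xx' dr] y x'y.
  have h1 := xr x' (le_ball _ xx'); have h2 : `|F x - F y| <= e / 2.
    by apply: xr; have := ball_triangle xx' (le_ball dr x'y); rewrite -splitr.
  have -> : F y - F x' = (F x - F x') - (F x - F y) by ring.
  apply: (le_trans (ler_normB _ _)).
  have : `|F x - F x'| <= e / 2 by apply: h1; lra.
  lra.
move=> H; near (0 : R)^'+ => d; exists d.
  by near: d; exact: nbhs_right_gt.
move=> x y Kx xy; have : K `<=` [set x | forall y, ball x d y -> `|F y - F x| <= e].
  by near: d.
by move=> /(_ x Kx); exact.
Unshelve. all: by end_near. Qed.

Lemma continuous_graph {R : realType} (u w : R -> R) :
  continuous u -> continuous w -> continuous (fun t => (t, u t, w t)).
Proof. by move=> cu cw t; apply: (cvg_pair (cvg_pair cvg_id (cu t)) (cw t)). Qed.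

Section uniform_composition.
Context {R : realType} {I : Type} (F : set_system I) {FF : Filter F}.
Implicit Types (T e h : R).

Lemma ucvg_comp T (phi : R -> R) (g : I -> R -> R) (g0 : R -> R) :
  continuous phi -> continuous g0 ->
  ucvg F T g g0 -> ucvg F T (fun n => phi \o g n) (phi \o g0).
Proof.
move=> cphi cg0 gg0 e e0.
have cK : compact (g0 @` `[0, T]).
  apply: continuous_compact; last exact: segment_compact.
  exact: continuous_subspaceT.
have [d d0 phid] := compact_unif_nbhs cK cphi e0.
have d20 : 0 < d / 2 by lra.
apply: filterS (gg0 _ d20) => n gn t tT; apply: phid.
  by exists t; rewrite //= in_itv.
by rewrite /ball/= distrC; apply: le_lt_trans (gn t tT) _; lra.
Qed.

Lemma ucvg_comp3 T (f : R -> R -> R -> R)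
    (u : I -> R -> R) (u0 : R -> R) (w : I -> R -> R) (w0 : R -> R) :
  continuous (fun p : R * R * R => f p.1.1 p.1.2 p.2) ->
  continuous u0 -> continuous w0 -> ucvg F T u u0 -> ucvg F T w w0 ->
  ucvg F T (fun n t => f t (u n t) (w n t)) (fun t => f t (u0 t) (w0 t)).
Proof.
move=> cf cu0 cw0 uu0 ww0 e e0.
have cK : compact ((fun t => (t, u0 t, w0 t)) @` `[0, T]).
  apply: continuous_compact; last exact: segment_compact.
  by apply: continuous_subspaceT; exact: continuous_graph.
have [d d0 fd] := compact_unif_nbhs cK cf e0.
have d20 : 0 < d / 2 by lra.
apply: filterS2 (uu0 _ d20) (ww0 _ d20) => n un wn t tT.
have := fd (t, u0 t, w0 t) (t, u n t, w n t); apply.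
  by exists t; rewrite //= in_itv.
split; [split|] => /=; first exact: ballxx.
  by rewrite /ball/= distrC; apply: le_lt_trans (un t tT) _; lra.
by rewrite /ball/= distrC; apply: le_lt_trans (wn t tT) _; lra.
Qed.

End uniform_composition.

Lemma compact_norm_bound {R : realType} {X : topologicalType} (K : set X) (F : X -> R) :
  compact K -> continuous F -> exists2 M, 0 <= M & forall x, K x -> `|F x| <= M.
Proof.
move=> cK cF.
have /compact_bounded[N [_ NF]] : compact (F @` K).
  by apply: continuous_compact => //; exact: continuous_subspaceT.
exists (`|N| + 1); first by rewrite addr_ge0.
move=> x Kx; apply: NF; last by exists x.
by apply: le_lt_trans (ler_norm _) _; lra.
Qed.

Lemma lipschitz_continuous {R : realType} (M : R) (V : R -> R) : 0 <= M ->
  (forall s t, `|V s - V t| <= M * `|s - t|) -> continuous V.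
Proof.
move=> M0 VM t; apply/cvgrPdist_le => e e0.
have M1 : 0 < M + 1 by lra.
have /cvgrPdist_le/(_ _ (divr_gt0 e0 M1)) : id s @[s --> t] --> t by exact: cvg_id.
apply: filterS => s ts; apply: (le_trans (VM _ _)).
rewrite ler_pdivlMr// in ts; apply: le_trans ts.
by rewrite mulrC ler_wpM2l//; lra.
Qed.

(** By compactness the image filter has a cluster point p. A neighbourhood of p whose preimage is
    not in G has the preimage of its complement in G, which contradicts clustering; so p is a
    limit. *)
Lemma ultra_compact_cvg {I : Type} {X : topologicalType} (G : set_system I)
    (f : I -> X) (K : set X) : UltraFilter G -> compact K -> (forall n, K (f n)) ->
  exists2 p, K p & f n @[n --> G] --> p.
Proof.
move=> GU cK Kf.
have [|p [Kp cp]] := cK (f @ G) (fmap_proper_filter f _).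
  by apply: (@filterS _ G _ setT); [move=> n _; exact: Kf|exact: filterT].
exists p => // B nB.
have [//|GnB] := in_ultra_setVsetC (f @^-1` B) GU.
by have [y []] := cp (~` B) B GnB nB.
Qed.

(** The equicontinuity half of Arzela-Ascoli: an e/3 argument around each point, made uniform by
    compactness of [0, T]. Pointwise limits along an ultrafilter are thereby uniform without
    extracting a subsequence. *)
Lemma ucvg_lipschitz {R : realType} {I : Type} (F : set_system I) {FF : Filter F}
    (T M : R) (g : I -> R -> R) (g0 : R -> R) : 0 <= M ->
  (forall n s t, 0 <= s <= T -> 0 <= t <= T -> `|g n s - g n t| <= M * `|s - t|) ->
  (forall s t, 0 <= s <= T -> 0 <= t <= T -> `|g0 s - g0 t| <= M * `|s - t|) ->
  (forall t, 0 <= t <= T -> g n t @[n --> F] --> g0 t) ->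
  ucvg F T g g0.
Proof.
move=> M0 gM g0M gg0 e e0.
have := @segment_compact R 0 T.
move/compact_near_coveringP/near_covering_withinP => cv.
have : \forall n \near F, `[0, T] `<=` [set t | `|g n t - g0 t| <= e].
  apply: cv => x /=; rewrite in_itv/= => xT.
  have d0 : 0 < e / 3 / (M + 1) by rewrite !divr_gt0// ltr_wpDl.
  have e30 : 0 < e / 3 by rewrite divr_gt0.
  have /cvgrPdist_le/(_ _ e30) gx := gg0 x xT.
  exists (ball x (e / 3 / (M + 1)), [set n | `|g0 x - g n x| <= e / 3]) => /=.
    by split; [exact: nbhsx_ballx|exact: gx].
  move=> [t n]/= [xt gnx]; rewrite in_itv/= => tT.
  have Mxt : M * `|x - t| <= e / 3.
    move/ltW : xt; rewrite ler_pdivlMr ?ltr_wpDl// => h.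
    apply: le_trans h; rewrite mulrC ler_wpM2l//; lra.
  have h1 := gM n x t xT tT; have h2 := g0M x t xT tT.
  move: h1 h2 gnx; rewrite !ler_norml => /andP[? ?] /andP[? ?] /andP[? ?].
  by apply/andP; split; lra.
by apply: filterS => n h t tT; apply: h; rewrite /= in_itv.
Qed.

Lemma mulr_le0_minmax {R : realFieldType} (x y : R) :
  x * y <= 0 -> Num.min x y <= 0 <= Num.max x y.
Proof.
move=> xy; rewrite ge_min le_max.
by case: (leP x 0) => x0; case: (leP y 0) => y0 //=; nra.
Qed.

(** * Backward shooting with delay *)

Section shooting.
Context {R : realType} (T K : R) (F : R -> R -> R -> R) (phi phi_inv : R -> R).
Hypotheses (T_gt0 : 0 < T) (K_ge0 : 0 <= K).
Hypothesis F_cont : continuous (fun p : R * R * R => F p.1.1 p.1.2 p.2).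
Hypotheses (phi_cont : continuous phi) (phi_inv_cont : continuous phi_inv).
Hypothesis phi_invK : cancel phi_inv phi.
Implicit Types (b t h : R) (w v : R -> R).

(** The right-hand side F(s, u, u') expressed through w = u' and b = u(T). *)
Definition nemytskii b w (s : R) := F s (prim T b w s) (w s).

Lemma continuous_nemytskii b w : continuous w -> continuous (nemytskii b w).
Proof.
move=> cw t; have cg := continuous_graph (@continuous_prim R T b w cw) cw.
exact: (continuous_comp (cg t) (@F_cont _)).
Qed.

Lemma ucvg_nemytskii {I : Type} (G : set_system I) {FG : Filter G}
    (b : I -> R) (b0 : R) (w : I -> R -> R) (w0 : R -> R) :
  (forall n, continuous (w n)) -> continuous w0 ->
  b n @[n --> G] --> b0 -> ucvg G T w w0 ->
  ucvg G T (fun n => nemytskii (b n) (w n)) (nemytskii b0 w0).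
Proof.
move=> cw cw0 bb0 ww0; apply: ucvg_comp3 => //; first exact: continuous_prim.
by apply: ucvg_prim => //; exact: ltW.
Qed.

(** The quantity Phi(b, w) of the overview. *)
Definition flux b w := tail T (nemytskii b w) 0.

Lemma cvg_flux {I : Type} (G : set_system I) {FG : Filter G}
    (b : I -> R) (b0 : R) (w : I -> R -> R) (w0 : R -> R) :
  (forall n, continuous (w n)) -> continuous w0 ->
  b n @[n --> G] --> b0 -> ucvg G T w w0 ->
  flux (b n) (w n) @[n --> G] --> flux b0 w0.
Proof.
move=> cw cw0 bb0 ww0.
have : ucvg G T (fun n t => tail T (nemytskii (b n) (w n)) (t + 0))
    (fun t => tail T (nemytskii b0 w0) (t + 0)).
  apply: ucvg_tail => //; first exact: ltW.
  - by move=> n; exact: continuous_nemytskii.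
  - exact: continuous_nemytskii.
  - exact: ucvg_nemytskii.
by move=> /(@ucvg_at _ _ _ _ _ _ _ 0); rewrite /flux addr0 lexx ltW//; exact.
Qed.

(* The delay h makes the value at t depend only on v over [t + h, T], so n + 1
   iterations determine a trajectory on [T - (n + 1) h, T]. *)
Definition shoot_step h b v t :=
  phi b - clamp (- K) K (tail T (nemytskii b (phi_inv \o v)) (t + h)).

Definition shoot h b n := iter n (shoot_step h b) (cst (phi b)).

Lemma continuous_phi_inv_comp v : continuous v -> continuous (phi_inv \o v).
Proof. by move=> cv t; apply: continuous_comp; [exact: cv|exact: phi_inv_cont]. Qed.

Lemma continuous_shoot_step h b v : continuous v -> continuous (shoot_step h b v).
Proof.
move=> cv t; apply: cvgB; first exact: cvg_cst.
apply: (@continuous_comp _ _ _ (fun t => tail T _ (t + h)) (clamp (- K) K)).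
  apply: (@continuous_comp _ _ _ (fun t => t + h)).
    by apply: cvgD; [exact: cvg_id|exact: cvg_cst].
  by apply: continuous_tail; apply: continuous_nemytskii; exact: continuous_phi_inv_comp.
exact: continuous_clamp.
Qed.

Lemma continuous_shoot h b n : continuous (shoot h b n).
Proof.
elim: n => [|n IHn]; first exact: cst_continuous.
exact: continuous_shoot_step.
Qed.

(** Induction on the number of iterations: each step preserves uniform convergence as b tends to b0.
    Continuity of F suffices, since the delay leaves only finitely many steps. *)
Lemma ucvg_shoot h b0 n : 0 <= h ->
  ucvg (nbhs b0) T (fun b => shoot h b n) (shoot h b0 n).
Proof.
move=> h0; elim: n => [|n IHn] e e0.
  have /cvgrPdist_le/(_ e e0) : phi b @[b --> b0] --> phi b0 by exact: phi_cont.
  by apply: filterS => b hb t _; rewrite distrC.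
have e20 : 0 < e / 2 by lra.
have cw b : continuous (phi_inv \o shoot h b n).
  by apply: continuous_phi_inv_comp; exact: continuous_shoot.
have cw0 := cw b0.
have tt0 : ucvg (nbhs b0) T
    (fun b t => tail T (nemytskii b (phi_inv \o shoot h b n)) (t + h))
    (fun t => tail T (nemytskii b0 (phi_inv \o shoot h b0 n)) (t + h)).
  apply: ucvg_tail => //; first exact: ltW.
  - by move=> b; exact: continuous_nemytskii.
  - exact: continuous_nemytskii.
  - apply: ucvg_nemytskii => //.
    by apply: ucvg_comp => //; exact: continuous_shoot.
have /cvgrPdist_le/(_ _ e20) : phi b @[b --> b0] --> phi b0 by exact: phi_cont.
apply: filterS2 (tt0 _ e20) => b h1 h2 t tT.
rewrite /= /shoot_step.
set x := tail _ _ _; set y := tail _ _ _.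
have -> : phi b - clamp (- K) K x - (phi b0 - clamp (- K) K y) =
  (phi b - phi b0) - (clamp (- K) K x - clamp (- K) K y) by ring.
apply: (le_trans (ler_normB _ _)); rewrite [leRHS]splitr distrC; apply: lerD => //.
by apply: (le_trans (clamp_lipschitz _ _ _ _)); exact: h1.
Qed.

(** For t + h >= T the tail is 0, and 0 lies in [-K, K], so both iterates equal phi(b). Otherwise a
    step at t reads the previous iterate on [t + h, T] only, also inside the primitive, and there
    the induction hypothesis applies. *)
Lemma shoot_stable h b n t : 0 <= h -> T <= t + n.+1%:R * h ->
  shoot h b n.+1 t = shoot h b n t.
Proof.
move=> h0; elim: n t => [|n IHn] t tT.
  rewrite /= /shoot_step tail_ge; last by rewrite mul1r in tT.
  by rewrite clamp_id ?subr0// oppr_le0 K_ge0.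
rewrite [LHS]/= [RHS]/= /shoot_step; congr (_ - clamp _ _ _).
have wE s : t + h <= s ->
    (phi_inv \o shoot h b n.+1) s = (phi_inv \o shoot h b n) s.
  move=> ts; rewrite /comp IHn//; apply: le_trans tT _.
  by rewrite [in leLHS]mulrSr mulrDl mul1r; lra.
apply: eq_Rintegral => s; rewrite inE/= in_itv/= => /andP[ts sT].
rewrite /nemytskii wE//; congr (F _ (_ - _) _).
apply: eq_Rintegral => x; rewrite inE/= in_itv/= => /andP[sx xT].
exact/wE/(le_trans ts).
Qed.

Lemma shoot_dist h b n t : `|shoot h b n t - phi b| <= K.
Proof.
case: n => [|n]; first by rewrite subrr normr0.
have NK : - K <= K by rewrite -subr_ge0 opprK addr_ge0.
by rewrite /= /shoot_step addrAC subrr add0r normrN ler_norml clamp_itv.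
Qed.

Lemma flux_shoot_zero h n b1 b2 : 0 <= h ->
  flux b1 (phi_inv \o shoot h b1 n) * flux b2 (phi_inv \o shoot h b2 n) <= 0 ->
  exists2 b, Num.min b1 b2 <= b <= Num.max b1 b2 & flux b (phi_inv \o shoot h b n) = 0.
Proof.
move=> h0; wlog b12 : b1 b2 / b1 <= b2 => [H|].
  case: (leP b1 b2) => [b12 q|/ltW b21].
    have [b bI bE] := H b1 b2 b12 q; exists b => //.
    by move: bI; rewrite (min_idPl b12) (max_idPr b12).
  rewrite mulrC => q; have [b bI bE] := H b2 b1 b21 q; exists b => //.
  by move: bI; rewrite (min_idPl b21) (max_idPr b21).
move=> flux_le0.
have cf : continuous (fun b => flux b (phi_inv \o shoot h b n)).
  move=> b; apply: cvg_flux => //.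
  - by move=> b'; apply: continuous_phi_inv_comp; exact: continuous_shoot.
  - by apply: continuous_phi_inv_comp; exact: continuous_shoot.
  - apply: ucvg_comp => //; [exact: continuous_shoot|exact: ucvg_shoot].
have [|b] := IVT b12 (continuous_subspaceT cf) (v := 0).
  exact: mulr_le0_minmax.
by rewrite in_itv/= => bI bE; exists b; rewrite // (min_idPl b12) (max_idPr b12).
Qed.

(** The sign condition is asked of every w with phi(w) within K of phi(b1) or phi(b2), because the
    delayed trajectories vary with h. The bound on the tail is used only for the limit, whose flux
    is 0, to drop the truncation. *)
Lemma shooting_solution b1 b2 :
  (forall w1 w2, continuous w1 -> continuous w2 ->
    (forall t, `|phi (w1 t) - phi b1| <= K) ->
    (forall t, `|phi (w2 t) - phi b2| <= K) -> flux b1 w1 * flux b2 w2 <= 0) ->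
  (forall b w, continuous w -> flux b w = 0 ->
    forall t, 0 <= t <= T -> `|tail T (nemytskii b w) t| <= K) ->
  exists b w, [/\ continuous w, flux b w = 0 & forall t, 0 <= t <= T ->
    phi (w t) = phi b - tail T (nemytskii b w) t].
Proof.
move=> flux_le0 tailK; pose h n : R := T / n.+1%:R.
have h_gt0 n : 0 < h n by rewrite divr_gt0.
pose lo := Num.min b1 b2; pose hi := Num.max b1 b2.
have /choice[b bP] : forall n, exists b : R,
    lo <= b <= hi /\ flux b (phi_inv \o shoot (h n) b n) = 0.
  move=> n; have [|b ? ?] := @flux_shoot_zero (h n) n b1 b2 (ltW (h_gt0 n)).
  - apply: flux_le0.
    + by apply: continuous_phi_inv_comp; exact: continuous_shoot.
    + by apply: continuous_phi_inv_comp; exact: continuous_shoot.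
    + by move=> t; rewrite /= phi_invK; exact: shoot_dist.
    + by move=> t; rewrite /= phi_invK; exact: shoot_dist.
  - by exists b.
pose v n := shoot (h n) (b n) n; pose w n := phi_inv \o v n.
pose N n := nemytskii (b n) (w n).
have cv n : continuous (v n) by exact: continuous_shoot.
have cw n : continuous (w n) by exact: continuous_phi_inv_comp.
have cN n : continuous (N n) by exact: continuous_nemytskii.
(* Since (n + 1) h(n) = T, stability holds at every t >= 0 and [v n] is a fixed point of the delayed
   step there. *)
have vE n t : 0 <= t -> v n t = phi (b n) - clamp (- K) K (tail T (N n) (t + h n)).
  move=> t0; rewrite -[RHS]/(shoot (h n) (b n) n.+1 t) shoot_stable ?(ltW (h_gt0 n))//.
  by rewrite /h mulrC divfK// lerDr.
have bI n : `[lo, hi]%classic (b n) by rewrite /= in_itv/=; exact: (bP n).1.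
(* Bounds independent of n follow in turn for phi(b), v, w = phi^-1(v), the primitive u and finally
   F(s, u, w); the last one, M, is a common Lipschitz constant of the [v n] on [0, T]. *)
have [B B0 phiB] := compact_norm_bound (@segment_compact R lo hi) phi_cont.
have vB n t : `|v n t| <= B + K.
  have := @shoot_dist (h n) (b n) n t; have := phiB _ (bI n); rewrite -/(v n).
  rewrite !ler_norml => /andP[? ?] /andP[? ?]; apply/andP; split; lra.
have [W W0 phiW] := compact_norm_bound (@segment_compact R (- (B + K)) (B + K)) phi_inv_cont.
have wB n t : `|w n t| <= W.
  by apply: phiW; rewrite /= in_itv/= -ler_norml.
have [b_ b_0 b_B] := compact_norm_bound (@segment_compact R lo hi) (fun x => @cvg_id _ (nbhs x)).
have uB n t : 0 <= t <= T -> `|prim T (b n) (w n) t| <= b_ + W * T.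
  move=> /andP[t0 tT]; apply: (le_trans (ler_normB _ _)).
  apply: lerD; first exact: b_B.
  have := @tail_lipschitz R T (w n) t T W (cw n) W0 tT (fun x _ => wB n x).
  rewrite (@tail_ge _ _ _ T)// subr0 => /le_trans; apply.
  by rewrite ler_wpM2l// gerBl.
have [M M0 FM] := compact_norm_bound (compact_setX (compact_setX (@segment_compact R 0 T)
  (@segment_compact R (- (b_ + W * T)) (b_ + W * T))) (@segment_compact R (- W) W)) F_cont.
have NM n t : 0 <= t <= T -> `|N n t| <= M.
  move=> tT; apply: (FM (t, prim T (b n) (w n) t, w n t)).
  by split; [split|] => /=; rewrite in_itv//= -ler_norml; [exact: uB|exact: wB].
have tailM n s t : 0 <= s <= t -> `|tail T (N n) s - tail T (N n) t| <= M * (t - s).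
  move=> /andP[s0 st]; apply: tail_lipschitz => // x; rewrite le_min => /and3P[sx _ xT].
  by apply: NM; rewrite xT (le_trans s0).
have vM n s t : 0 <= s <= T -> 0 <= t <= T -> `|v n s - v n t| <= M * `|s - t|.
  wlog st : s t / s <= t.
    move=> H sT tT; case: (leP s t) => [st|/ltW ts]; first exact: H.
    by rewrite distrC (distrC s); exact: H.
  move=> /andP[s0 sT] /andP[t0 tT]; rewrite !vE// opprB addrC addrA subrK.
  apply: (le_trans (clamp_lipschitz _ _ _ _)); rewrite distrC.
  apply: (le_trans (tailM _ _ _ _)); first by rewrite addr_ge0 ?lerD2r// ltW.
  by rewrite distrC (ger0_norm (_ : 0 <= t - s)) ?subr_ge0// ler_wpM2l//; lra.
have [G [GU Goo]] := ultraFilterLemma (@eventually_filter).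
have /choice[V0 V0P] : forall t : R, exists p : R, v n t @[n --> G] --> p.
  move=> t; have [|p _ vp] := @ultra_compact_cvg _ R G (v ^~ t) _ GU
    (@segment_compact R (- (B + K)) (B + K)).
    by move=> n; rewrite /= in_itv/= -ler_norml.
  by exists p.
have [b0 _ bb0] := ultra_compact_cvg GU (@segment_compact R lo hi) bI.
(* The Lipschitz bound is known on [0, T] only; clamping the time makes the limit Lipschitz on the
   whole line. *)
pose V t := V0 (clamp 0 T t).
have VP t : 0 <= t <= T -> v n t @[n --> G] --> V t.
  by move=> tT; rewrite /V clamp_id//; exact: V0P.
have clT t : 0 <= clamp 0 T t <= T by apply: clamp_itv; exact: ltW.
have VM s t : `|V s - V t| <= M * `|s - t|.
  apply: (@le_trans _ _ (M * `|clamp 0 T s - clamp 0 T t|)); last first.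
    by rewrite ler_wpM2l// clamp_lipschitz.
  have : `|v n (clamp 0 T s) - v n (clamp 0 T t)| @[n --> G] --> `|V s - V t|.
    by apply: cvg_norm; apply: cvgB; exact: V0P.
  move=> /cvgr_to_le; apply; apply: (@filterS _ G _ setT); last exact: filterT.
  by move=> n _; exact: vM.
have cV : continuous V by exact: lipschitz_continuous VM.
pose w0 := phi_inv \o V; pose N0 := nemytskii b0 w0.
have cw0 : continuous w0 by exact: continuous_phi_inv_comp.
have cN0 : continuous N0 by exact: continuous_nemytskii.
have ww0 : ucvg G T w w0.
  by apply: ucvg_comp => //; apply: (ucvg_lipschitz M0) => // s t _ _; exact: VM.
have NN0 : ucvg G T N N0 by exact: ucvg_nemytskii.
have flux0 : flux b0 w0 = 0.
  have : flux (b n) (w n) @[n --> G] --> flux b0 w0 by exact: cvg_flux.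
  under eq_cvg do rewrite (bP _).2.
  by move=> h0; apply: (cvg_unique _ h0); [exact: Rhausdorff|exact: cvg_cst].
have VE t : 0 <= t <= T -> V t = phi b0 - clamp (- K) K (tail T N0 t).
  move=> tT; have /andP[t0 _] := tT.
  (* Moving the argument by h(n) changes the tail by at most M h(n) = M T / (n + 1), which tends to
     0; this removes the delay. *)
  have tt : tail T (N n) (t + h n) @[n --> G] --> tail T N0 t.
    apply/cvgrPdist_le => e e0; have e20 : 0 < e / 2 by lra.
    have : ucvg G T (fun n t => tail T (N n) (t + 0)) (fun t => tail T N0 (t + 0)).
      by apply: ucvg_tail => //; exact: ltW.
    move=> /(_ _ e20).
    have : (M * T) * @harmonic R n @[n --> \oo] --> (M * T) * 0.
      by apply: cvgM; [exact: cvg_cst|exact: cvg_harmonic].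
    move/cvgrPdist_le => /(_ _ e20)/Goo.
    apply: filterS2 => n h1 /(_ t tT); rewrite !addr0 => h2.
    have tth : 0 <= t <= t + h n by rewrite t0/= lerDl ltW.
    have := tailM n _ _ tth; have -> : M * (t + h n - t) = M * T * harmonic n.
      by rewrite addrAC subrr add0r -mulrA.
    move: h1 h2; rewrite mulr0 sub0r normrN !ler_norml.
    by move=> /andP[? ?] /andP[? ?] /andP[? ?]; apply/andP; split; lra.
  have vV := VP t tT.
  have : v n t @[n --> G] --> phi b0 - clamp (- K) K (tail T N0 t).
    under eq_cvg do rewrite vE//.
    apply: cvgB; first by apply: continuous_cvg => //; exact: phi_cont.
    by apply: continuous_cvg => //; exact: continuous_clamp.
  by apply: cvg_unique vV; exact: Rhausdorff.
exists b0, w0; split=> // t tT; rewrite /= phi_invK VE// clamp_id//.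
by rewrite -ler_norml; exact: tailK.
Qed.

End shooting.

(** * Signed count of the simple roots of a polynomial *)

Lemma sgz_no_root {R : rcfType} (p : {poly R}) (x y : R) : x <= y ->
  (forall z, x <= z <= y -> p.[z] != 0) -> sgz p.[x] = sgz p.[y].
Proof.
move=> xy p0.
have px : p.[x] != 0 by apply: p0; rewrite lexx.
have py : p.[y] != 0 by apply: p0; rewrite lexx andbT.
have nox (q : {poly R}) : (forall z, x <= z <= y -> q.[z] != 0) ->
    q.[x] < 0 -> q.[y] < 0.
  move=> q0 qx; rewrite ltNge; apply/negP => qy.
  have [|z] := @poly_ivt _ q _ _ xy; first by rewrite (ltW qx).
  by move=> zI /rootP qz; have := q0 z zI; rewrite qz eqxx.
case: (ltgtP p.[x] 0) px => // px _.
  by rewrite (ltr0_sgz px) (ltr0_sgz (nox _ p0 px)).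
rewrite (gtr0_sgz px) gtr0_sgz//.
have := nox (- p); rewrite !hornerN !oppr_lt0; apply=> // z /p0.
by rewrite hornerN oppr_eq0.
Qed.

(** At successive simple roots the polynomial crosses 0 alternately upwards and downwards, so the
    sum depends on the signs at the two ends only; it is 0 when these agree. *)
Lemma sum_sgz_simple_roots {R : rcfType} (p : {poly R}) (x y : R) : x < y ->
  p.[x] != 0 -> p.[y] != 0 ->
  (forall z, x < z < y -> p.[z] = 0 -> p^`().[z] != 0) ->
  exists s : seq R, [/\ uniq s, forall z, z \in s = (x < z < y) && (p.[z] == 0) &
    \sum_(z <- s) sgz p^`().[z] *+ 2 = sgz p.[y] - sgz p.[x]].
Proof.
have [n] := ubnP (size p).
elim: n p x y => // n IHn p x y pn xy px py simple.
have [[r rI pr]|noroot] := pselect (exists2 r, x < r < y & p.[r] = 0); last first.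
  exists [::]; split=> //.
    move=> z; rewrite in_nil; apply/esym/negP => /andP[zI /eqP pz].
    by apply: noroot; exists z.
  rewrite big_nil (@sgz_no_root _ p x y) ?subrr ?(ltW xy)// => z.
  rewrite !le_eqVlt => /andP[/predU1P[<-//|xz] /predU1P[->//|zy]].
  by apply/negP => /eqP pz; apply: noroot; exists z; rewrite ?xz.
have /andP[xr ry] := rI.
(* Dividing by 'X - r for an arbitrary root r flips the signs of the derivative
   at the roots left of r, and the induction applies on both sides of r. *)
have [q pE] : exists q, p = q * ('X - r%:P) by apply/factor_theorem/rootP.
have pqz z : p.[z] = q.[z] * (z - r) by rewrite pE !hornerE.
have dpz z : p^`().[z] = q^`().[z] * (z - r) + q.[z].
  by rewrite pE derivM derivXsubC mulr1 hornerD hornerM hornerXsubC.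
have qr : q.[r] != 0.
  by have := simple r rI pr; rewrite dpz subrr mulr0 add0r.
have qx : q.[x] != 0 by apply: contraNneq px => qx; rewrite pqz qx mul0r.
have qy : q.[y] != 0 by apply: contraNneq py => qy; rewrite pqz qy mul0r.
have q0 : q != 0 by apply: contraNneq qr => ->; rewrite horner0.
have qn : (size q < n)%N by move: pn; rewrite pE size_Mmonic ?monicXsubC// size_XsubC addn2.
have simq z : x < z < y -> q.[z] = 0 -> q^`().[z] != 0.
  move=> zI qz; have := simple z zI; rewrite pqz qz mul0r dpz qz addr0 => /(_ erefl).
  by rewrite mulf_eq0 negb_or => /andP[].
have [s1 [us1 s1P sum1]] : exists s : seq R, [/\ uniq s,
    forall z, z \in s = (x < z < r) && (q.[z] == 0) &
    \sum_(z <- s) sgz q^`().[z] *+ 2 = sgz q.[r] - sgz q.[x]].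
  apply: IHn => // z /andP[xz zr]; apply: simq.
  by rewrite xz (lt_trans zr).
have [s2 [us2 s2P sum2]] : exists s : seq R, [/\ uniq s,
    forall z, z \in s = (r < z < y) && (q.[z] == 0) &
    \sum_(z <- s) sgz q^`().[z] *+ 2 = sgz q.[y] - sgz q.[r]].
  apply: IHn => // z /andP[rz zy]; apply: simq.
  by rewrite zy (lt_trans xr).
exists (s1 ++ r :: s2); split.
- rewrite cat_uniq us1/= us2 s2P ltxx/= andbT.
  apply/norP; split; first by rewrite s1P ltxx andbF.
  apply/hasPn => z; rewrite s2P s1P => /andP[/andP[rz _] _].
  by rewrite negb_and negb_and -(leNgt r) (ltW rz) orbT.
- move=> z; rewrite mem_cat inE s1P s2P pqz mulf_eq0 subr_eq0.
  case: (ltgtP z r) => [zr|rz|->] //=; rewrite ?andbT ?andbF ?orbF ?orbT.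
  + by rewrite (lt_trans zr ry) andbT.
  + by rewrite (lt_trans xr rz).
  + by rewrite xr ry.
- rewrite big_cat big_cons /= (_ : \sum_(z <- s1) _ = - \sum_(z <- s1) sgz q^`().[z] *+ 2).
    rewrite (_ : \sum_(z <- s2) _ = \sum_(z <- s2) sgz q^`().[z] *+ 2).
      (* With s the sign of q, the sum is -(s(r) - s(x)) + 2 s(r) + (s(y) - s(r)) = s(y) + s(x), and
         x - r < 0 turns s(x) into minus the sign of p(x). *)
      rewrite sum1 sum2 dpz subrr mulr0 add0r !pqz !sgzM.
      rewrite (gtr0_sgz (_ : 0 < y - r)) ?subr_gt0//.
      by rewrite (ltr0_sgz (_ : x - r < 0)) ?subr_lt0// mulr2n; ring.
    apply: eq_big_seq => z; rewrite s2P => /andP[/andP[rz zy] /eqP qz].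
    by rewrite dpz qz addr0 sgzM (gtr0_sgz (_ : 0 < z - r)) ?subr_gt0// mulr1.
  rewrite -sumrN; apply: eq_big_seq => z; rewrite s1P => /andP[/andP[xz zr] /eqP qz].
  by rewrite dpz qz addr0 sgzM (ltr0_sgz (_ : z - r < 0)) ?subr_lt0// mulrN1 mulNrn.
Qed.

(** An elementary Sard statement: either p' = 0 and p is constant, or p' has finitely many roots,
    found by dividing them out. *)
Lemma finite_critical_values {R : rcfType} (p : {poly R}) :
  exists s : seq R, forall z, p^`().[z] = 0 -> p.[z] \in s.
Proof.
have [dp0|dp0] := eqVneq (p^`()) 0.
  exists [:: p.[0]] => z _; rewrite inE; apply/eqP.
  suff /size1_polyC -> : (size p <= 1)%N by rewrite !hornerC.
  apply/leq_sizeP => -[//|i] _; have /eqP : p^`()`_i = 0 by rewrite dp0 coef0.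
  by rewrite coef_deriv mulrn_eq0 /= => /eqP.
have [s sP] : exists s : seq R, forall z, p^`().[z] = 0 -> z \in s.
  move: (p^`()) dp0 => q q0; have [n] := ubnP (size q).
  elim: n q q0 => // n IHn q q0 qn.
  have [[r qr]|noroot] := pselect (exists r, q.[r] = 0); last first.
    by exists [::] => z qz; case: noroot; exists z.
  have [q' qE] : exists q', q = q' * ('X - r%:P) by apply/factor_theorem/rootP.
  have q'0 : q' != 0 by apply: contraNneq q0; rewrite qE => ->; rewrite mul0r.
  have [|s sP] := IHn q' q'0.
    by move: qn; rewrite qE size_Mmonic ?monicXsubC// size_XsubC addn2.
  exists (r :: s) => z /eqP; rewrite qE !hornerE mulf_eq0 subr_eq0 inE.
  by case/orP => [/eqP/sP ->|->//]; rewrite orbT.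
by exists [seq p.[z] | z <- s] => z /sP zs; apply: map_f.
Qed.

(** The numbers e / (i + 2) are distinct and lie strictly between 0 and e; one more of them than
    entries of s leaves one outside s. *)
Lemma exists_notin_itv {R : realFieldType} (s : seq R) (e : R) : 0 < e ->
  exists2 x, 0 < x < e & x \notin s.
Proof.
move=> e0; pose u (i : nat) := e / i.+2%:R.
have u_inj : injective u.
  move=> i j /(mulfI (lt0r_neq0 e0)) /invr_inj /eqP.
  by rewrite eqr_nat !eqSS => /eqP.
have [/allP us|/allPn[x /mapP[i _ ->] uis]] :=
  boolP (all (mem s) [seq u i | i <- iota 0 (size s).+1]).
  have := uniq_leq_size (_ : uniq [seq u i | i <- iota 0 (size s).+1]) us.
  by rewrite map_inj_uniq// iota_uniq size_map size_iota ltnn => /(_ isT).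
exists (u i) => //; rewrite divr_gt0//= ltr_pdivrMr// ltr_pMr//.
by rewrite ltr1n.
Qed.

(** * Bernstein approximation in two variables *)

Section bernstein.
Context {R : realType}.
Implicit Types (x y : R) (u : nat -> R).

(* The expectation of u at a binomial variable with n trials of probability x. *)
Fixpoint bernstein (n : nat) x u : R :=
  if n is m.+1 then x * bernstein m x (fun k => u k.+1) + (1 - x) * bernstein m x u
  else u 0%N.

Lemma bernstein_le n x u v : 0 <= x <= 1 -> (forall k, u k <= v k) ->
  bernstein n x u <= bernstein n x v.
Proof.
move=> /andP[x0 x1]; elim: n u v => [|n IHn] u v uv /=; first exact: uv.
by apply: lerD; apply: ler_wpM2l; rewrite ?subr_ge0//; apply: IHn => k; exact: uv.
Qed.

Lemma bernsteinD n x u v :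
  bernstein n x (fun k => u k + v k) = bernstein n x u + bernstein n x v.
Proof. by elim: n u v => [|n IHn] u v //=; rewrite !IHn; ring. Qed.

Lemma bernsteinZ n x c u : bernstein n x (fun k => c * u k) = c * bernstein n x u.
Proof. by elim: n u => [|n IHn] u //=; rewrite !IHn; ring. Qed.

Lemma bernstein_cst n x c : bernstein n x (fun=> c) = c.
Proof. by elim: n => [|n IHn] //=; rewrite !IHn; ring. Qed.

(** The shift c makes the induction work: a success in one trial replaces c by 1 + c. Taking c = - n
    x gives the variance. *)
Lemma bernstein_sqr n x c : bernstein n x (fun k => (k%:R + c) ^+ 2) =
  (n%:R * x + c) ^+ 2 + n%:R * (x * (1 - x)).
Proof.
elim: n c => [|n IHn] c /=; first by ring.
rewrite (_ : (fun k => _) = (fun k => (k%:R + (1 + c)) ^+ 2)); last first.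
  by apply/funext => k; rewrite mulrSr addrA.
by rewrite !IHn mulrSr; ring.
Qed.

Lemma bernstein_var n x :
  bernstein n.+1 x (fun k => (k%:R / n.+1%:R - x) ^+ 2) = x * (1 - x) / n.+1%:R.
Proof.
have n0 : n.+1%:R != 0 :> R by [].
rewrite (_ : (fun k => _) = (fun k => n.+1%:R^-2 * (k%:R + - (n.+1%:R * x)) ^+ 2)).
  by rewrite bernsteinZ bernstein_sqr; field.
by apply/funext => k; field.
Qed.

(** The weights do not depend on u; this is what separates the variables in two dimensions. *)
Lemma bernstein_poly n : exists l : seq (nat * {poly R}), forall x u,
  bernstein n x u = \sum_(p <- l) u p.1 * p.2.[x].
Proof.
elim: n => [|n [l lP]].
  by exists [:: (0%N, 1%:P)] => x u; rewrite big_seq1 hornerC mulr1.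
exists ([seq (p.1.+1, 'X * p.2) | p <- l] ++ [seq (p.1, (1%:P - 'X) * p.2) | p <- l]) => x u.
rewrite big_cat !big_map /= !lP !mulr_sumr.
congr (_ + _); apply: eq_bigr => p _.
  by rewrite hornerM hornerX; ring.
by rewrite hornerM hornerD hornerN hornerX hornerC; ring.
Qed.

(** Two-variable polynomials are kept as sums of products p(x) q(y), so that partial derivatives
    reduce to derivatives in one variable. *)
Definition bipoly (l : seq ({poly R} * {poly R})) x y : R :=
  \sum_(p <- l) p.1.[x] * p.2.[y].

Lemma bernstein2_bipoly n (F : nat -> nat -> R) : exists l, forall x y,
  bernstein n x (fun i => bernstein n y (F i)) = bipoly l x y.
Proof.
have [l lP] := bernstein_poly n.
exists [seq (F p.1 q.1 *: p.2, q.2) | p <- l, q <- l] => x y.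
rewrite lP /bipoly big_allpairs_dep; apply: eq_bigr => p _.
rewrite lP mulr_suml; apply: eq_bigr => q _ /=.
by rewrite hornerZ; ring.
Qed.

(** Chebyshev's argument: F(x', y') differs from F(x, y) by at most e/2 plus C times the squared
    distances, and the averages of these are variances. As [bernstein_le] compares at all natural
    indices, nodes beyond 1 occur, whence the bound M on the whole plane. *)
Lemma weierstrass2_unit (F : R * R -> R) (M e : R) : continuous F -> 0 < e ->
  (forall p, `|F p| <= M) ->
  exists l, forall x y, 0 <= x <= 1 -> 0 <= y <= 1 -> `|bipoly l x y - F (x, y)| <= e.
Proof.
move=> cF e0 FM; have e20 : 0 < e / 2 by lra.
have [d d0 Fd] := compact_unif_nbhs
  (compact_setX (@segment_compact R 0 1) (@segment_compact R 0 1)) cF e20.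
have M0 : 0 <= M by apply: le_trans (FM (0, 0)).
(* When a coordinate differs by at least d, its quadratic term alone exceeds the trivial bound
   2M. *)
pose C := 2 * M / d ^+ 2.
have C0 : 0 <= C by rewrite !mulr_ge0// invr_ge0 exprn_ge0// ltW.
have FC x y x' y' : 0 <= x <= 1 -> 0 <= y <= 1 ->
    `|F (x', y') - F (x, y)| <= e / 2 + (C * (x' - x) ^+ 2 + C * (y' - y) ^+ 2).
  move=> xI yI.
  have far z z' : d <= `|z - z'| -> 2 * M <= C * (z' - z) ^+ 2.
    move=> dz; rewrite /C -mulrA ler_peMr ?mulr_ge0// mulrC ler_pdivlMr ?exprn_gt0// mul1r.
    by rewrite -(real_normK (num_real (z' - z))) distrC lerXn2r ?nnegrE// ltW.
  have F2M : `|F (x', y') - F (x, y)| <= 2 * M.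
    apply: (le_trans (ler_normB _ _)).
    by have := FM (x', y'); have := FM (x, y); lra.
  have [C1 C2] : 0 <= C * (x' - x) ^+ 2 /\ 0 <= C * (y' - y) ^+ 2.
    by split; apply: mulr_ge0 => //; exact: sqr_ge0.
  have [xd|/far] := ltP `|x - x'| d; last by lra.
  have [yd|/far] := ltP `|y - y'| d; last by lra.
  apply: (@le_trans _ _ (e / 2)); last by lra.
  apply: Fd; first by split; rewrite /= in_itv.
  by split.
(* Since z (1 - z) <= 1/4, this n makes each of the two variance terms at most e/4. *)
pose n := Num.bound (C / e).
have nC : C / e <= n.+1%:R.
  apply: (@le_trans _ _ n%:R); last by rewrite ler_nat.
  by apply/ltW/archi_boundP; rewrite divr_ge0// ltW.
pose B x y := bernstein n.+1 x (fun i => bernstein n.+1 y (fun j =>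
  F (i%:R / n.+1%:R, j%:R / n.+1%:R))).
have [l lP] := bernstein2_bipoly n.+1 (fun i j => F (i%:R / n.+1%:R, j%:R / n.+1%:R)).
exists l => x y xI yI; rewrite -lP -/(B x y).
have key (s : R) : `|s| = 1 -> s * (B x y - F (x, y)) <= e.
  move=> s1.
  have -> : s * (B x y - F (x, y)) =
      bernstein n.+1 x (fun i => bernstein n.+1 y (fun j =>
        s * (F (i%:R / n.+1%:R, j%:R / n.+1%:R) + - F (x, y)))).
    under eq_fun do rewrite bernsteinZ bernsteinD bernstein_cst.
    by rewrite bernsteinZ bernsteinD bernstein_cst.
  apply: (@le_trans _ _ (bernstein n.+1 x (fun i => bernstein n.+1 y (fun j =>
     (e / 2 + C * (i%:R / n.+1%:R - x) ^+ 2) + C * (j%:R / n.+1%:R - y) ^+ 2)))).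
    apply: bernstein_le => // i; apply: bernstein_le => // j.
    apply: (le_trans (ler_norm _)); rewrite normrM s1 mul1r -addrA.
    exact: FC.
  under eq_fun do rewrite bernsteinD bernstein_cst bernsteinZ bernstein_var.
  rewrite !bernsteinD !bernstein_cst bernsteinZ bernstein_var.
  have quarter z : 0 <= z <= 1 -> C * (z * (1 - z) / n.+1%:R) <= e / 4.
    move=> /andP[z0 z1]; have : C <= e * n.+1%:R by rewrite -ler_pdivrMl// mulrC.
    move=> Ce; rewrite mulrA ler_pdivrMr//.
    have : z * (1 - z) <= 4^-1 by have := sqr_ge0 (z - 2^-1); lra.
    have : 0 <= z * (1 - z) by rewrite mulr_ge0// subr_ge0.
    by move=> ? ?; nra.
  apply: (le_trans (lerD (lerD (lexx _) (quarter x xI)) (quarter y yI))).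
  lra.
rewrite ler_norml; apply/andP; split.
  by have := key (-1) (normrN1 _); lra.
by have := key 1 (normr1 _); lra.
Qed.

Lemma weierstrass2 (F : R * R -> R) (X e : R) : continuous F -> 0 < X -> 0 < e ->
  exists l, forall x y, `|x| <= X -> `|y| <= X -> `|bipoly l x y - F (x, y)| <= e.
Proof.
move=> cF X0 e0.
(* The affine map takes [0, 1] onto [-X, X]; clamping makes the transported function bounded on the
   whole plane. *)
pose a z := clamp (- X) X (2 * X * z - X).
pose G (p : R * R) := F (a p.1, a p.2).
have ca : continuous a.
  move=> z; apply: (@continuous_comp _ _ _ (fun z => 2 * X * z - X) (clamp (- X) X));
    last exact: continuous_clamp.
  apply: cvgB; last exact: cvg_cst.
  by apply: cvgM; [exact: cvg_cst|exact: cvg_id].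
have cG : continuous G.
  move=> p; apply: (@continuous_comp _ _ _ (fun p : R * R => (a p.1, a p.2)) F); last exact: cF.
  have c1 : a q.1 @[q --> p] --> a p.1.
    by apply: (@continuous_comp _ _ _ fst a); [exact: cvg_fst|exact: ca].
  have c2 : a q.2 @[q --> p] --> a p.2.
    by apply: (@continuous_comp _ _ _ snd a); [exact: cvg_snd|exact: ca].
  exact: (cvg_pair c1 c2).
have NXX : - X <= X by lra.
have [M M0 FM] := compact_norm_bound (compact_setX (@segment_compact R (- X) X)
  (@segment_compact R (- X) X)) cF.
have GM p : `|G p| <= M.
  by apply: FM; split; rewrite /= in_itv/=; exact: clamp_itv.
have [l lP] := weierstrass2_unit cG e0 GM.
pose L : {poly R} := (2 * X)^-1 *: 'X + (2^-1)%:P.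
exists [seq (p.1 \Po L, p.2 \Po L) | p <- l] => x y.
have LE z : L.[z] = z / (2 * X) + 2^-1 by rewrite /L !hornerE; ring.
have LI z : `|z| <= X -> 0 <= L.[z] <= 1 /\ a L.[z] = z.
  rewrite ler_norml => /andP[Xz zX]; rewrite LE.
  have zE : z = (z / (2 * X)) * (2 * X) by field; lra.
  split; last first.
    rewrite /a (_ : _ - X = z) ?clamp_id ?Xz//; field; lra.
  have ? : - 2^-1 <= z / (2 * X) by rewrite ler_pdivlMr; lra.
  have ? : z / (2 * X) <= 2^-1 by rewrite ler_pdivrMr; lra.
  by apply/andP; split; lra.
move=> /LI[xI ax] /LI[yI ay].
have := lP _ _ xI yI; rewrite /G /= ax ay; congr (`|_ - _| <= _).
by rewrite /bipoly big_map; apply: eq_bigr => p _; rewrite !horner_comp.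
Qed.

End bernstein.

(** * Polynomial maps of the plane *)

Section plane.
Context {R : realType}.
Implicit Types (x y : R) (v : 'rV[R]_2) (l : seq ({poly R} * {poly R})).

Definition pt x y : 'rV[R]_2 := \row_(i < 2) if i == 0 then x else y.

Lemma pt0 x y : pt x y 0 0 = x. Proof. by rewrite mxE. Qed.
Lemma pt1 x y : pt x y 0 1 = y. Proof. by rewrite mxE. Qed.

Lemma ord2P (i : 'I_2) : i = 0 \/ i = 1.
Proof. by case: i => -[|[|//]] ?; [left|right]; apply/val_inj. Qed.

Lemma pt_eta v : v = pt (v 0 0) (v 0 1).
Proof.
by apply/rowP => i; case: (ord2P i) => ->; rewrite ?pt0 ?pt1.
Qed.

Lemma pt_inj x y x' y' : pt x y = pt x' y' -> x = x' /\ y = y'.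
Proof.
by move=> /rowP E; have := E 0; have := E 1; rewrite !mxE /= => -> ->.
Qed.

Lemma norm_pt_le x y e : 0 <= e -> (`|pt x y| <= e) = (`|x| <= e) && (`|y| <= e).
Proof.
move=> e0; rewrite /Num.Def.normr/= mx_normrE; apply/idP/andP.
- move=> h; split; apply: le_trans h.
  + have := @le_bigmax _ _ _ 0 (fun ij : 'I_1 * 'I_2 => `|pt x y ij.1 ij.2|) (0, 0).
    by rewrite /= pt0.
  + have := @le_bigmax _ _ _ 0 (fun ij : 'I_1 * 'I_2 => `|pt x y ij.1 ij.2|) (0, 1).
    by rewrite /= pt1.
- move=> [xe ye]; apply: bigmax_le => // -[i j] _ /=; rewrite ord1.
  by case: (ord2P j) => ->; rewrite ?pt0 ?pt1.
Qed.

Lemma ptB x y x' y' : pt x y - pt x' y' = pt (x - x') (y - y').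
Proof. by apply/rowP => i; rewrite !mxE; case: ifP. Qed.

Lemma ptE x y : pt x y = x *: delta_mx 0 0 + y *: delta_mx 0 1.
Proof.
apply/rowP => i; case: (ord2P i) => ->; rewrite ?pt0 ?pt1 !mxE/=; ring.
Qed.

Lemma continuous_pt {V : topologicalType} (F G : V -> R) :
  continuous F -> continuous G -> continuous (fun p : V => pt (F p) (G p)).
Proof.
move=> cF cG; under eq_fun do rewrite ptE.
by move=> p; exact: (cvgD (cvgZr_tmp (cF p)) (cvgZr_tmp (cG p))).
Qed.

Lemma det2 (A : 'M[R]_2) : \det A = A 0 0 * A 1 1 - A 0 1 * A 1 0.
Proof.
rewrite (expand_det_row _ 0) !big_ord_recl big_ord0 /cofactor !det_mx11 !mxE /=.
rewrite (_ : lift 0 0 = 1 :> 'I_2); last exact/val_inj.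
rewrite (_ : lift 1 0 = 0 :> 'I_2); last exact/val_inj.
by rewrite /= expr0 expr1; ring.
Qed.

Definition bipoly_dx l := [seq (p.1^`(), p.2) | p <- l].
Definition bipoly_dy l := [seq (p.1, p.2^`()) | p <- l].

Lemma is_diff_coord v (j : 'I_2) :
  is_diff v (fun w : 'rV[R]_2 => w 0 j) (fun w : 'rV[R]_2 => w 0 j).
Proof.
apply: DiffDef; first exact: differentiable_coord.
have @f : {linear 'rV[R]_2 -> R}.
  by exists (fun N : 'rV[R]_2 => N 0 j); do 2![eexists]; do ?[constructor];
     rewrite ?mxE// => ? *; rewrite ?mxE//; move=> ?; rewrite !mxE.
by rewrite (_ : (fun _ => _) = f)// diff_lin//; exact: coord_continuous.
Qed.

Lemma is_diff_horner (p : {poly R}) x : is_diff x (horner p) (fun h => h *: p^`().[x]).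
Proof.
have dp : differentiable (horner p) x by apply/derivable1_diffP/derivable_horner.
by apply: DiffDef => //; rewrite diff1E// -derivE.
Qed.

Lemma is_diff_bipoly l v :
  is_diff v (fun w : 'rV[R]_2 => bipoly l (w 0 0) (w 0 1))
    (fun h => bipoly (bipoly_dx l) (v 0 0) (v 0 1) * h 0 0 +
              bipoly (bipoly_dy l) (v 0 0) (v 0 1) * h 0 1).
Proof.
elim: l => [|[p q] l IHl].
  rewrite (_ : (fun w => _) = cst 0); last by apply/funext => w; rewrite /bipoly big_nil.
  apply: is_diff_eq (is_diff_cst _ _) _.
  by apply/funext => h; rewrite /bipoly !big_nil !mul0r addr0.
rewrite (_ : (fun w => _) = ((horner p \o (fun w : 'rV[R]_2 => w 0 0)) *
    (horner q \o (fun w : 'rV[R]_2 => w 0 1)) : 'rV[R]_2 -> R) +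
    (fun w : 'rV[R]_2 => bipoly l (w 0 0) (w 0 1))); last first.
  by apply/funext => w; rewrite /bipoly big_cons.
have dp := is_diff_comp (is_diff_coord v 0) (is_diff_horner p (v 0 0)).
have dq := is_diff_comp (is_diff_coord v 1) (is_diff_horner q (v 0 1)).
apply: is_diff_eq (is_diffD (is_diffM dp dq) IHl) _.
apply/funext => h; rewrite /bipoly /= !big_cons /=.
rewrite [LHS](_ : _ = p.[v 0 0] * (h 0 1 * q^`().[v 0 1]) +
  q.[v 0 1] * (h 0 0 * p^`().[v 0 0]) +
  ((\sum_(p0 <- bipoly_dx l) p0.1.[v 0 0] * p0.2.[v 0 1]) * h 0 0 +
   (\sum_(p0 <- bipoly_dy l) p0.1.[v 0 0] * p0.2.[v 0 1]) * h 0 1)); last by [].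
by ring.
Qed.

Lemma continuous_bipoly l : continuous (fun v : 'rV[R]_2 => bipoly l (v 0 0) (v 0 1)).
Proof.
move=> v; apply: differentiable_continuous.
by have := is_diff_bipoly l v; case.
Qed.

Definition polymap l l' v := pt (bipoly l (v 0 0) (v 0 1)) (bipoly l' (v 0 0) (v 0 1)).

(** Row vectors are multiplied on the left, so rows correspond to variables and columns to
    components. *)
Definition polyjac l l' v : 'M[R]_2 :=
  bipoly (bipoly_dx l) (v 0 0) (v 0 1) *: delta_mx 0 0 +
  bipoly (bipoly_dx l') (v 0 0) (v 0 1) *: delta_mx 0 1 +
  (bipoly (bipoly_dy l) (v 0 0) (v 0 1) *: delta_mx 1 0 +
  bipoly (bipoly_dy l') (v 0 0) (v 0 1) *: delta_mx 1 1).

Lemma is_diff_polymap l l' v :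
  is_diff v (polymap l l') (fun h => h *m polyjac l l' v).
Proof.
have d1 := is_diff_bipoly l v; have d2 := is_diff_bipoly l' v.
have dd1 := is_diff_comp d1 (is_diff_scalel (bipoly l (v 0 0) (v 0 1)) (delta_mx 0 0 : 'rV[R]_2)).
have dd2 := is_diff_comp d2 (is_diff_scalel (bipoly l' (v 0 0) (v 0 1)) (delta_mx 0 1 : 'rV[R]_2)).
have := is_diffD dd1 dd2.
rewrite (_ : _ + _ = polymap l l'); last by apply/funext => w; rewrite /polymap ptE.
move=> /is_diff_eq; apply; apply/funext => h.
rewrite [LHS](_ : _ = (bipoly (bipoly_dx l) (v 0 0) (v 0 1) * h 0 0 +
    bipoly (bipoly_dy l) (v 0 0) (v 0 1) * h 0 1) *: delta_mx 0 0 +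
  (bipoly (bipoly_dx l') (v 0 0) (v 0 1) * h 0 0 +
    bipoly (bipoly_dy l') (v 0 0) (v 0 1) * h 0 1) *: delta_mx 0 1); last by [].
rewrite /polyjac.
rewrite [in RHS](pt_eta h) ptE.
apply/rowP => i; rewrite !mxE !big_ord_recl big_ord0 !mxE /=.
by case: (ord2P i) => -> /=; ring.
Qed.

Lemma jacobian_polymap l l' : jacobian (polymap l l') = polyjac l l'.
Proof.
apply/funext => v; have [_ d] := is_diff_polymap l l' v.
apply/matrixP => i j; rewrite /jacobian mxE d -rowE.
by rewrite mxE.
Qed.

Lemma continuous_polyjac l l' : continuous (polyjac l l').
Proof.
have c (A : 'M[R]_2) k :
    continuous (fun w : 'rV[R]_2 => bipoly k (w 0 0) (w 0 1) *: A).
  by move=> w; exact: (cvgZr_tmp (@continuous_bipoly k w)).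
by move=> v; exact: (cvgD (cvgD (c _ _ v) (c _ _ v)) (cvgD (c _ _ v) (c _ _ v))).
Qed.

Lemma continuous_polymap l l' : continuous (polymap l l').
Proof. by apply: continuous_pt; exact: continuous_bipoly. Qed.

Lemma det_polyjac l l' v : \det (polyjac l l' v) =
  bipoly (bipoly_dx l) (v 0 0) (v 0 1) * bipoly (bipoly_dy l') (v 0 0) (v 0 1) -
  bipoly (bipoly_dx l') (v 0 0) (v 0 1) * bipoly (bipoly_dy l) (v 0 0) (v 0 1).
Proof. by rewrite det2 /polyjac !mxE /=; ring. Qed.

End plane.

(** * The ball of affine functions and the degree of G *)

Section affine_norm.
Context {R : realType} (T : R).
Hypothesis T_gt0 : 0 < T.
Implicit Types (v : 'rV[R]_2) (x y : R).

Lemma sup_attained (A : set R) x : A x -> ubound A x -> sup A = x.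
Proof.
move=> Ax ubx; apply/le_anti/andP; split; first by apply: ge_sup => //; exists x.
by apply: sup_upper_bound => //; split; exists x.
Qed.

Lemma affine_prim v : {in `[0, T]%classic,
  affine v =1 prim T (v 0 0 + v 0 1 * T) (cst (v 0 1))}.
Proof.
move=> t; rewrite inE/= in_itv/= => /andP[t0 tT].
by rewrite /affine /prim /tail Rintegral_cst_itv//; ring.
Qed.

Lemma derive_on_affine v : {in `[0, T], derive_on `[0, T] (affine v) =1 cst (v 0 1)}.
Proof.
exact: (prim_C1 T_gt0 (@cst_continuous _ _ (v 0 1)) (@affine_prim v)).2.
Qed.

(** Convexity: T (a + b t) = (T - t) a + t (a + b T). The products below are the inequalities at the
    two ends with these weights. *)
Lemma norm_affine_le (a b t M : R) : 0 <= t <= T ->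
  `|a| <= M -> `|a + b * T| <= M -> `|a + b * t| <= M.
Proof.
move=> /andP[t0 tT]; rewrite !ler_norml => /andP[a1 a2] /andP[b1 b2].
have p1 : 0 <= (T - t) * (M - a) by rewrite mulr_ge0// subr_ge0.
have p2 : 0 <= (T - t) * (a - - M) by rewrite mulr_ge0// subr_ge0.
have p3 : 0 <= t * (M - (a + b * T)) by rewrite mulr_ge0// subr_ge0.
have p4 : 0 <= t * (a + b * T - - M) by rewrite mulr_ge0// subr_ge0.
apply/andP; split; rewrite -(ler_pM2l T_gt0); nra.
Qed.

Definition anorm v := Num.max `|v 0 0| `|v 0 0 + v 0 1 * T| + `|v 0 1|.

Lemma C1_norm_affine v : C1_norm `[0, T] (affine v) = anorm v.
Proof.
have T0 : 0 <= T by exact: ltW.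
rewrite /C1_norm /anorm /sup_norm; congr (_ + _); apply: sup_attained.
- have [_|_] := leP `|v 0 0| `|v 0 0 + v 0 1 * T|.
    by exists T; rewrite //= in_itv/= T0 lexx.
  by exists 0; rewrite /= ?in_itv/= ?T0 ?lexx// /affine mulr0 addr0.
- move=> _ [t /= + <-]; rewrite in_itv/= /affine => /andP[t0 tT].
  by apply: norm_affine_le; rewrite ?t0 ?le_max ?lexx ?orbT.
- exists 0; first by rewrite /= in_itv/= lexx.
  by rewrite /= derive_on_affine// in_itv/= lexx.
- by move=> _ [t /= tI <-]; rewrite /= derive_on_affine.
Qed.

Lemma continuous_anorm : continuous anorm.
Proof.
have c0 := @coord_continuous R 1 2 0 0; have c1 := @coord_continuous R 1 2 0 1.
have c2 : continuous (fun v : 'rV[R]_2 => `|v 0 0 + v 0 1 * T|).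
  by move=> v; exact: (cvg_norm (cvgD (c0 v) (cvgM (c1 v) (cvg_cst T)))).
have c3 : continuous (fun v : 'rV[R]_2 => `|v 0 0|).
  by move=> v; exact: (cvg_norm (c0 v)).
move=> v; have c4 := continuous_max (c3 v) (c2 v).
exact: (cvgD c4 (cvg_norm (c1 v))).
Qed.

Lemma anorm_coord v : `|v 0 0| <= anorm v /\ `|v 0 1| <= anorm v.
Proof.
rewrite /anorm; set M := Num.max _ _.
have : `|v 0 0| <= M by rewrite le_max lexx.
have := normr_ge0 (v 0 0); have := normr_ge0 (v 0 1); move=> *; split; lra.
Qed.

Lemma affine_ballE rho : affine_ball T rho = [set v | anorm v < rho].
Proof. by apply/funext => v; rewrite /affine_ball /= C1_norm_affine. Qed.

Lemma affine_sphereE rho : affine_sphere T rho = [set v | anorm v = rho].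
Proof. by apply/funext => v; rewrite /affine_sphere /= C1_norm_affine. Qed.

Lemma closure_affine_ball rho v : closure (affine_ball T rho) v -> anorm v <= rho.
Proof.
have cl : closed [set v | anorm v <= rho].
  rewrite (_ : mkset _ = anorm @^-1` [set x | x <= rho])//.
  by apply: preimage_closed; [move=> w _; exact: continuous_anorm|exact: closed_le].
move: cl => /closure_id clE.
have := closure_subset (_ : affine_ball T rho `<=` [set v | anorm v <= rho]).
move=> sub /sub; rewrite -clE; apply.
by rewrite affine_ballE => w /= /ltW.
Qed.

Lemma compact_affine_sphere rho : compact (affine_sphere T rho).
Proof.
apply: bounded_closed_compact; last first.
  rewrite affine_sphereE (_ : mkset _ = anorm @^-1` [set x | x = rho])//.
  by apply: preimage_closed; [move=> w _; exact: continuous_anorm|exact: closed_eq].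
exists (`|rho| + 1); split; first exact: num_real.
move=> M rM v; rewrite affine_sphereE /= => vr.
have [h0 h1] := anorm_coord v; rewrite (pt_eta v) norm_pt_le.
  have := ler_norm rho; rewrite vr in h0 h1.
  by move=> ?; apply/andP; split; lra.
by have := normr_ge0 rho; lra.
Qed.

End affine_norm.

Section degree_zero.
Context {R : realType} (T rho : R) (h : R -> R -> R).
Hypotheses (T_gt0 : 0 < T) (rho_gt0 : 0 < rho).
Hypothesis h_cont : continuous (fun p : R * R => h p.1 p.2).

(** The map G with its integral abstracted to h(a, b): G is then approximated through h alone, its
    linear part being kept exactly. *)
Definition gmap (v : 'rV[R]_2) : 'rV[R]_2 :=
  pt (v 0 0 * T + v 0 1 * T ^+ 2 - v 0 1 * T - T^-1 * h (v 0 0) (v 0 1))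
     (v 0 1 - v 0 0 - v 0 1 * T).

(* The zero set of the second component of gmap. *)
Definition critical_line b := pt (b * (1 - T)) b.

(* The C^1 ball of radius rho meets the critical line in |b| < radius. *)
Definition radius := rho / (Num.max `|1 - T| 1 + 1).

Lemma radius_den_gt0 : 0 < Num.max `|1 - T| 1 + 1.
Proof. by rewrite addr_gt0// lt_max ltr01 orbT. Qed.

Lemma anorm_critical_line b : anorm T (critical_line b) = `|b| * (Num.max `|1 - T| 1 + 1).
Proof.
rewrite /anorm pt0 pt1 [RHS]mulrDr mulr1; congr (_ + _).
have -> : b * (1 - T) + b * T = b by ring.
by rewrite normrM -[X in Num.max _ X]mulr1 maxr_pMr.
Qed.

Lemma affine_ball_critical_line b : affine_ball T rho (critical_line b) <-> `|b| < radius.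
Proof.
by rewrite affine_ballE//= anorm_critical_line /radius ltr_pdivlMr ?radius_den_gt0.
Qed.

Lemma affine_sphere_critical_line b : `|b| = radius -> affine_sphere T rho (critical_line b).
Proof.
rewrite affine_sphereE//= anorm_critical_line /radius => ->.
by rewrite divfK// gt_eqF// radius_den_gt0.
Qed.

Lemma continuous_gmap : continuous gmap.
Proof.
have c0 := @coord_continuous R 1 2 0 0; have c1 := @coord_continuous R 1 2 0 1.
have ch : continuous (fun v : 'rV[R]_2 => h (v 0 0) (v 0 1)).
  move=> v; apply: (@continuous_comp _ _ _ (fun v : 'rV[R]_2 => (v 0 0, v 0 1))
    (fun p : R * R => h p.1 p.2)); last exact: h_cont.
  exact: (cvg_pair (c0 v) (c1 v)).
apply: continuous_pt => v.
- exact: (cvgB (cvgB (cvgD (cvgM (c0 v) (cvg_cst T)) (cvgM (c1 v) (cvg_cst (T ^+ 2))))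
    (cvgM (c1 v) (cvg_cst T))) (cvgM (cvg_cst T^-1) (ch v))).
- exact: (cvgB (cvgB (c1 v) (c0 v)) (cvgM (c1 v) (cvg_cst T))).
Qed.

Hypothesis gmap_neq0 : forall v, affine_sphere T rho v -> gmap v != 0.

Lemma gmap_sphere_lower_bound :
  exists2 d, 0 < d & forall v, affine_sphere T rho v -> d <= `|gmap v|.
Proof.
have r0 : 0 < radius by rewrite divr_gt0// radius_den_gt0.
have S0 : affine_sphere T rho !=set0.
  by exists (critical_line radius); apply: affine_sphere_critical_line; rewrite gtr0_norm.
have cg : continuous (fun v => `|gmap v|).
  by move=> v; exact: (cvg_norm (@continuous_gmap v)).
have [v Sv vmin] := EVT_min_rV S0 (@compact_affine_sphere R T T_gt0 rho)
  (continuous_subspaceT cg).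
exists `|gmap v|; first by rewrite normr_gt0 gmap_neq0//; exact: set_mem.
by move=> w Sw; apply: vmin; exact: mem_set.
Qed.

(** The zeros of the approximant g are the points of the critical line at the roots of a polynomial
    k, and det J is -k'/T there. The signed count is thus half a difference of the signs of k at the
    two ends, which agree because k is close to h. *)
Lemma brouwer_degree_eq0 :
  0 < h (radius * (1 - T)) radius * h (- radius * (1 - T)) (- radius) ->
  brouwer_degree (affine_ball T rho) gmap 0 = 0.
Proof.
move=> hh; have T0 : T != 0 by rewrite gt_eqF.
have r0 : 0 < radius by rewrite divr_gt0// radius_den_gt0.
have [d d0 dG] := gmap_sphere_lower_bound.
(* Half of the error T d / 2 goes to the polynomial and half to c. Divided by T it stays below d, as
   required of g; it is also less than the lower bound T d for |h| at the ends of the line. *)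
have e0 : 0 < T * d / 4 by rewrite !mulr_gt0// invr_gt0.
have [l0 l0P] := weierstrass2 h_cont rho_gt0 e0.
pose k0 : {poly R} := \sum_(p <- l0) (p.1 \Po ((1 - T) *: 'X)) * p.2.
have k0E b : k0.[b] = bipoly l0 (b * (1 - T)) b.
  rewrite /k0 horner_sum; apply: eq_bigr => p _.
  by rewrite hornerM horner_comp hornerZ hornerX (mulrC b).
(* A small constant c makes 0 a regular value on the critical line. *)
have [s sP] := finite_critical_values k0.
have [c /andP[c0 ce] cs] := exists_notin_itv [seq - x | x <- s] e0.
pose k := k0 + c%:P.
have kE b : k.[b] = bipoly l0 (b * (1 - T)) b + c by rewrite hornerD hornerC k0E.
have simple z : k.[z] = 0 -> k^`().[z] != 0.
  move=> kz; apply/eqP; rewrite /k derivD derivC addr0 => /sP k0s.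
  move/negP: cs; apply; apply/mapP; exists k0.[z] => //.
  by move: kz; rewrite kE -k0E => /eqP; rewrite addrC addr_eq0 => /eqP.
pose H x y := bipoly l0 x y + c.
have Hh x y : `|x| <= rho -> `|y| <= rho -> `|H x y - h x y| <= T * d / 2.
  move=> xr yr; have := l0P x y xr yr; rewrite /H /= !ler_norml => /andP[? ?].
  by apply/andP; split; lra.
pose l1 : seq ({poly R} * {poly R}) := (T *: 'X, 1%:P) :: (1%:P, (T ^+ 2 - T) *: 'X) ::
  ((- (T^-1 * c))%:P, 1%:P) :: [seq (- T^-1 *: p.1, p.2) | p <- l0].
pose l2 : seq ({poly R} * {poly R}) := [:: (1%:P, (1 - T) *: 'X); (- 'X, 1%:P)].
have l1E x y : bipoly l1 x y = x * T + y * T ^+ 2 - y * T - T^-1 * H x y.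
  rewrite /bipoly /l1 !big_cons big_map /=.
  under eq_bigr do rewrite hornerZ -mulrA.
  by rewrite -mulr_sumr -/(bipoly l0 x y) !hornerZ !hornerX !hornerC /H; ring.
have l2E x y : bipoly l2 x y = y - x - y * T.
  by rewrite /bipoly /l2 !big_cons big_nil /= !hornerZ !hornerN !hornerX !hornerC; ring.
pose g := polymap l1 l2.
have gE v : g v = pt (v 0 0 * T + v 0 1 * T ^+ 2 - v 0 1 * T - T^-1 * H (v 0 0) (v 0 1))
    (v 0 1 - v 0 0 - v 0 1 * T) by rewrite /g /polymap l1E l2E.
have dxE x y : bipoly (bipoly_dx l1) x y = T - T^-1 * bipoly (bipoly_dx l0) x y.
  rewrite /bipoly /l1 !big_map !big_cons !big_map /=.
  under eq_bigr do rewrite derivZ hornerZ -mulrA.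
  by rewrite -mulr_sumr !(derivZ, derivX, derivC) !hornerZ !hornerC; ring.
have dyE x y : bipoly (bipoly_dy l1) x y = T ^+ 2 - T - T^-1 * bipoly (bipoly_dy l0) x y.
  rewrite /bipoly /l1 !big_map !big_cons !big_map /=.
  under eq_bigr do rewrite hornerZ -mulrA.
  by rewrite -mulr_sumr !(derivZ, derivX, derivC) !hornerZ !hornerC; ring.
have dx2E x y : bipoly (bipoly_dx l2) x y = - 1.
  rewrite /bipoly /l2 !big_map !big_cons !big_nil /=.
  by rewrite !(derivN, derivX, derivC) !hornerN !hornerC; ring.
have dy2E x y : bipoly (bipoly_dy l2) x y = 1 - T.
  rewrite /bipoly /l2 !big_map !big_cons !big_nil /=.
  by rewrite !(derivN, derivZ, derivX, derivC) !hornerZ !hornerC; ring.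
have dkE b : k^`().[b] = (1 - T) * bipoly (bipoly_dx l0) (b * (1 - T)) b +
    bipoly (bipoly_dy l0) (b * (1 - T)) b.
  rewrite /k derivD derivC addr0 /k0 raddf_sum horner_sum /bipoly !big_map mulr_sumr -big_split.
  apply: eq_bigr => p _ /=; rewrite derivM deriv_comp derivZ derivX hornerD !hornerM.
  by rewrite !horner_comp !hornerZ hornerX hornerC (mulrC b); ring.
(* The linear contributions T (1 - T) and T^2 - T cancel. *)
have detE b : \det ('J g (critical_line b)) = - (T^-1 * k^`().[b]).
  rewrite jacobian_polymap det_polyjac pt0 pt1 dxE dyE dx2E dy2E dkE.
  by field.
have g0 v : g v = 0 <-> exists2 b, v = critical_line b & k.[b] = 0.
  have -> : 0 = pt 0 0 :> 'rV[R]_2 by apply/rowP => i; rewrite !mxE; case: ifP.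
  rewrite gE; split.
    move=> /pt_inj[e1 e2]; exists (v 0 1).
      rewrite {1}(pt_eta v) /critical_line; congr pt; lra.
    have e3 : v 0 0 = v 0 1 * (1 - T) by lra.
    move: e1; rewrite e3 => e1.
    have : - (T^-1 * H (v 0 1 * (1 - T)) (v 0 1)) = 0 by rewrite -[RHS]e1; ring.
    by move=> /eqP; rewrite oppr_eq0 mulf_eq0 invr_eq0 (negbTE T0) /= => /eqP; rewrite kE.
  move=> [b -> kb]; rewrite pt0 pt1 /H -kE kb mulr0 subr0; congr pt; ring.
(* On the critical line the second component of [gmap] and the linear part of the first vanish, so
   its norm is |h| / T. *)
have far b : `|b| = radius -> T * d <= `|h (b * (1 - T)) b|.
  move=> bI; have := dG _ (affine_sphere_critical_line bI).
  rewrite /gmap pt0 pt1.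
  have -> : b - b * (1 - T) - b * T = 0 by ring.
  have -> : b * (1 - T) * T + b * T ^+ 2 - b * T - T^-1 * h (b * (1 - T)) b =
    - (T^-1 * h (b * (1 - T)) b) by ring.
  move=> /le_trans/(_ (_ : _ <= `|T^-1 * h (b * (1 - T)) b|)).
  rewrite norm_pt_le// normrN lexx normr0 normr_ge0 => /(_ isT).
  by rewrite normrM normfV (gtr0_norm T_gt0) mulrC ler_pdivlMr// mulrC.
have near b : `|b| = radius -> `|k.[b] - h (b * (1 - T)) b| <= T * d / 2.
  move=> bI; have := affine_sphere_critical_line bI; rewrite affine_sphereE//= => an.
  have [] := anorm_coord T (critical_line b); rewrite an pt0 pt1 kE.
  exact: Hh.
have n1 : `|radius| = radius by rewrite gtr0_norm.
have n2 : `|- radius| = radius by rewrite normrN.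
have := near _ n1; have := near _ n2; have := far _ n1; have := far _ n2.
move: hh; set h1 := h _ _; set h2 := h _ _.
set k1 := k.[radius]; set k2 := k.[- radius] => hh f2 f1 n2' n1'.
have Td : 0 < T * d by rewrite mulr_gt0.
have sgk : [/\ k2 != 0, k1 != 0 & sgz k1 = sgz k2].
  have [h1_gt0|h1_lt0|h10] := ltgtP h1 0; last by move: hh; rewrite h10 mul0r ltxx.
    have h2_lt0 : h2 < 0 by rewrite -(nmulr_rgt0 _ h1_gt0).
    move: f1 f2 n1' n2'; rewrite (ltr0_norm h1_gt0) (ltr0_norm h2_lt0) !ler_norml.
    move=> ? ? /andP[? ?] /andP[? ?].
    have k1_lt0 : k1 < 0 by lra.
    have k2_lt0 : k2 < 0 by lra.
    by rewrite !ltr0_sgz// !lt_eqF.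
  have h2_gt0 : 0 < h2 by rewrite -(pmulr_rgt0 _ h1_lt0).
  move: f1 f2 n1' n2'; rewrite (gtr0_norm h1_lt0) (gtr0_norm h2_gt0) !ler_norml.
  move=> ? ? /andP[? ?] /andP[? ?].
  have k1_gt0 : 0 < k1 by lra.
  have k2_gt0 : 0 < k2 by lra.
  by rewrite !gtr0_sgz// !gt_eqF.
have [k2n k1n k12] := sgk.
have rr : - radius < radius by lra.
have [z [uz zP sumz]] := sum_sgz_simple_roots rr k2n k1n (fun b _ => @simple b).
have Jdet : signed_count (affine_ball T rho) g 0 = 0.
  rewrite /signed_count (reindex_fsbig critical_line [set` z]); last first.
    split.
    - move=> b /=; rewrite zP => /andP[/andP[b1 b2] /eqP kb]; split.
        by apply/affine_ball_critical_line; rewrite ltr_norml b1 b2.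
      by apply/g0; exists b.
    - by move=> b b' _ _ /pt_inj[].
    - move=> v /= [Uv /g0[b vE kb]]; exists b => //=.
      move: Uv; rewrite vE => /affine_ball_critical_line.
      by rewrite zP kb eqxx andbT ltr_norml.
  rewrite -fsbig_seq//.
  under eq_bigr do rewrite detE sgzN sgzM (gtr0_sgz (_ : 0 < T^-1)) ?invr_gt0// mul1r.
  rewrite sumrN; move/eqP: sumz; rewrite k12 subrr sumrMnl mulrn_eq0 /= => /eqP ->.
  by rewrite oppr0.
have gapprox : degree_approx (affine_ball T rho) gmap 0 g.
  split.
  - by apply: continuous_subspaceT; exact: continuous_polymap.
  - by move=> v _; have := is_diff_polymap l1 l2 v; case.
  - by apply: continuous_subspaceT; rewrite jacobian_polymap; exact: continuous_polyjac.
  - move=> v _ /g0[b -> kb]; rewrite detE oppr_eq0 mulf_neq0 ?invr_eq0//.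
    exact: simple.
  - exists d; split.
      move=> v [cv nv]; rewrite subr0; apply: dG.
      rewrite affine_sphereE//=; apply/le_anti; rewrite closure_affine_ball//=.
      by rewrite leNgt; apply/negP => vr; apply: nv; rewrite affine_ballE.
    move=> v cv; have an := closure_affine_ball T_gt0 cv.
    have [a0 a1] := anorm_coord T v.
    have := Hh _ _ (le_trans a0 an) (le_trans a1 an).
    rewrite gE /gmap ptB; set w := v 0 1 - _ - _; rewrite subrr => HHh.
    apply: (@le_lt_trans _ _ (d / 2)); last by lra.
    rewrite norm_pt_le ?divr_ge0 ?(ltW d0)// normr0 divr_ge0 ?(ltW d0)// andbT.
    rewrite (_ : _ - _ = - (T^-1 * (H (v 0 0) (v 0 1) - h (v 0 0) (v 0 1)))); last by ring.
    rewrite normrN normrM normfV (gtr0_norm T_gt0) mulrC ler_pdivrMr//.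
    by rewrite mulrAC (mulrC d).
(* If no integer is a degree, the default value is 0; otherwise g computes the degree. *)
rewrite /brouwer_degree; case: xgetP => // m _ [_ mP].
by rewrite -(mP g gapprox).
Qed.

End degree_zero.

(** With k a clamp of the time variable, this extends f and c continuously beyond [0, T]. *)
Lemma within_continuous_comp {X Y Z : topologicalType} (A : set Y) (k : X -> Y) (g : Y -> Z) :
  continuous k -> (forall x, A (k x)) -> {within A, continuous g} -> continuous (g \o k).
Proof.
move=> ck Ak /subspace_continuousP cg x B /(cg _ (Ak x)) gB.
by move: (ck x _ gB); apply: (@filterS _ (nbhs x)) => y /(_ (Ak y)).
Qed.

(** * Constant sign of the flux and conclusion *)

Section flux_sign.
Context {R : realType} (T : R) (F : R -> R -> R -> R) (Q : set R).
Hypothesis T_gt0 : 0 < T.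
Hypothesis F_cont : continuous (fun p : R * R * R => F p.1.1 p.1.2 p.2).
Hypothesis Q_convex : forall x y s : R, 0 <= s <= 1 -> Q x -> Q y -> Q (x + s * (y - x)).
Hypothesis flux_neq0 : forall b w, continuous w ->
  (forall t, 0 <= t <= T -> Q (w t)) -> flux T F b w != 0.

(** Along the segment from (b, w) to (b', w') the flux is continuous and, by convexity of Q, never
    0, so the intermediate value theorem forbids a change of sign. The terminal values are
    unconstrained. *)
Lemma flux_same_sign b (w : R -> R) b' (w' : R -> R) : continuous w -> continuous w' ->
  (forall t, 0 <= t <= T -> Q (w t)) -> (forall t, 0 <= t <= T -> Q (w' t)) ->
  0 < flux T F b w * flux T F b' w'.
Proof.
move=> cw cw' Qw Qw'; rewrite ltNge; apply/negP => flux_le0.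
pose bs s := b + s * (b' - b); pose ws s t := w t + s * (w' t - w t).
have cd := continuousB_fun cw' cw.
have cws s : continuous (ws s).
  by move=> t; exact: (cvgD (cw t) (cvgM (cvg_cst s) (cd t))).
have ws0 : ws 0 = w by apply/funext => t; rewrite /ws mul0r addr0.
have ws1 : ws 1 = w' by apply/funext => t; rewrite /ws mul1r addrC subrK.
have [M M0 wM] := compact_norm_bound (@segment_compact R 0 T) cd.
have cflux : continuous (fun s => flux T F (bs s) (ws s)).
  move=> s; apply: cvg_flux => //.
    exact: (cvgD (cvg_cst b) (cvgM (@cvg_id _ (nbhs s)) (cvg_cst (b' - b)))).
  move=> e e0; have M1 : 0 < M + 1 by lra.
  have /cvgrPdist_le/(_ _ (divr_gt0 e0 M1)) : id x @[x --> s] --> s by exact: cvg_id.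
  apply: filterS => s' ss' t tT.
  have -> : ws s' t - ws s t = (s' - s) * (w' t - w t) by rewrite /ws; ring.
  rewrite normrM distrC; rewrite ler_pdivlMr// in ss'; apply: le_trans ss'.
  apply: ler_wpM2l => //; apply: (le_trans (wM t _)); first by rewrite /= in_itv.
  lra.
have [||s] := @IVT R _ 0 1 0 _ (continuous_subspaceT cflux) _.
- by [].
- rewrite /bs mul0r addr0 mul1r.
  by rewrite ws0 ws1 (addrC b) subrK; exact: mulr_le0_minmax.
- rewrite in_itv/= => s01 /eqP; apply/negP; apply: flux_neq0 => // t tT.
  by apply: Q_convex => //; [exact: Qw|exact: Qw'].
Qed.

End flux_sign.

(** * Integral inequalities and monotone homeomorphisms of the line *)

Lemma tail_nonneg_le {R : realType} (T t : R) (m : R -> R) : continuous m ->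
  (forall s, 0 <= m s) -> 0 <= t <= T ->
  0 <= tail T m t <= tail T m 0 /\ \int[lebesgue_measure]_(s in `[0, t]) m s <= tail T m 0.
Proof.
move=> cm m0 /andP[t0 tT]; rewrite (tail_split cm t0 tT).
have i1 : 0 <= tail T m t by exact: Rintegral_ge0.
have i2 : 0 <= \int[lebesgue_measure]_(s in `[0, t]) m s by exact: Rintegral_ge0.
by rewrite i1 lerDr i2 lerDl i1.
Qed.

Lemma le_Rintegral_itv {R : realType} (a b : R) (g w : R -> R) :
  continuous g -> continuous w -> (forall x, a <= x <= b -> g x <= w x) ->
  \int[lebesgue_measure]_(s in `[a, b]) g s <= \int[lebesgue_measure]_(s in `[a, b]) w s.
Proof.
by move=> cg cw gw; apply: le_Rintegral => //; exact: continuous_integrable.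
Qed.

Lemma RintegralN_itv {R : realType} (a b : R) (g : R -> R) : continuous g ->
  \int[lebesgue_measure]_(s in `[a, b]) (- g s) = - (\int[lebesgue_measure]_(s in `[a, b]) g s).
Proof.
move=> cg; under eq_Rintegral do rewrite -mulN1r.
by rewrite RintegralZl ?mulN1r//; exact: continuous_integrable.
Qed.

Lemma continuous_bijection_monotone {R : realType} (g g_inv : R -> R) :
  cancel g g_inv -> continuous g ->
  (forall x y, x <= y -> g x <= g y) \/ (forall x y, x <= y -> g y <= g x).
Proof.
move=> gK cg.
have := @itv_continuous_inj_mono R g `]-oo, +oo[ (continuous_subspaceT cg)
  (in2W (can_inj gK)).
case=> gm; [left|right] => x y xy.
  by move: xy; rewrite le_eqVlt => /predU1P[->//|xy]; apply/ltW/gm.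
by move: xy; rewrite le_eqVlt => /predU1P[->//|xy]; apply/ltW/gm.
Qed.

(** Here v stands for phi(w(t)). Placing phi(b) at phi(M) + K or phi(M) - K keeps v on one side of
    phi(M); which choice serves which claim depends on whether phi increases or decreases. *)
Lemma thresholds {R : realType} (phi phi_inv : R -> R) (K M : R) :
  homeomorphism phi phi_inv ->
  (exists b, forall v, `|v - phi b| <= K -> M <= phi_inv v) /\
  (exists b, forall v, `|v - phi b| <= K -> phi_inv v <= M).
Proof.
move=> [phiK phi_invK cphi cphi_inv].
have [mono|mono] := continuous_bijection_monotone phi_invK cphi_inv.
- split; [exists (phi_inv (phi M + K))|exists (phi_inv (phi M - K))] => v;
  rewrite phi_invK ler_norml => /andP[? ?]; rewrite -[M]phiK; apply: mono; rewrite ?phiK; lra.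
- split; [exists (phi_inv (phi M - K))|exists (phi_inv (phi M + K))] => v;
  rewrite phi_invK ler_norml => /andP[? ?]; rewrite -[M]phiK; apply: mono; rewrite ?phiK; lra.
Qed.

(** By monotonicity M lies between phi^-1(-L) and phi^-1(L), in one order or the other. *)
Lemma norm_le_max_phi_inv {R : realType} (phi phi_inv : R -> R) (L M : R) :
  homeomorphism phi phi_inv -> `|phi M| <= L ->
  `|M| <= Num.max `|phi_inv L| `|phi_inv (- L)|.
Proof.
move=> [phiK phi_invK cphi cphi_inv]; rewrite ler_norml => /andP[h1 h2].
have key x y : x <= M <= y -> `|M| <= Num.max `|x| `|y|.
  move=> /andP[xM My]; rewrite le_max; have [M0|M0] := leP 0 M.
    by rewrite (ger0_norm M0) (le_trans My (ler_norm _)) orbT.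
  rewrite (ltr0_norm M0) -(normrN x) (le_trans _ (ler_norm _))//.
  by rewrite lerN2.
have [mono|mono] := continuous_bijection_monotone phi_invK cphi_inv.
- by rewrite maxC; apply: key; rewrite -[M]phiK !mono.
- by apply: key; rewrite -[M]phiK !mono.
Qed.

Theorem theorem5p5 (R : realType) (T : R) (phi phi_inv : R -> R)
  (f : R -> R -> R -> R) (c : R -> R) (M1 M2 rho : R)
  (T_gt0 : 0 < T)
  (phi_homeo : homeomorphism phi phi_inv)
  (phi0 : phi 0 = 0)
  (f_cont : {within [set p : R * R * R | p.1.1 \in `[0, T]],
               continuous (fun p : R * R * R => f p.1.1 p.1.2 p.2)})
  (c_cont : {within `[0, T], continuous c})
  (f_ge_c : forall t x y : R, t \in `[0, T] -> c t <= f t x y)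
  (M1_lt_M2 : M1 < M2)
  (int_neq0_M2 : forall u : R -> R, C1_on `[0, T] u ->
     (forall t, t \in `[0, T] -> M2 <= derive_on `[0, T] u t) ->
     nonlin_integral T f u != 0)
  (int_neq0_M1 : forall u : R -> R, C1_on `[0, T] u ->
     (forall t, t \in `[0, T] -> derive_on `[0, T] u t <= M1) ->
     nonlin_integral T f u != 0) :
  let c_minus := \int[lebesgue_measure]_(t in `[0, T]) Num.max (- c t) 0 in
  let L := Num.max `|phi M2| `|phi M1| in
  let r := Num.max `|phi_inv (L + 2 * c_minus)|
                   `|phi_inv (- L - 2 * c_minus)| in
  r * (2 + T) <= rho ->
  (forall v : 'rV[R]_2, affine_sphere T rho v -> G_map T f v != 0) ->
  brouwer_degree (affine_ball T rho) (G_map T f) 0 != 0 ->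
  exists u : R -> R, is_solution T phi f u.
Proof.
move=> K L r r_rho G_neq0 deg_neq0.
have [phiK phi_invK phi_cont phi_inv_cont] := phi_homeo.
have T_ge0 : 0 <= T by exact: ltW.
have clampT t : 0 <= clamp 0 T t <= T by exact: clamp_itv.
(* Freezing time outside [0, T] gives a function continuous everywhere; c^- is extended likewise as
   [m] below. *)
pose F t x y := f (clamp 0 T t) x y.
have FE t x y : 0 <= t <= T -> F t x y = f t x y by move=> tT; rewrite /F clamp_id.
have F_cont : continuous (fun p : R * R * R => F p.1.1 p.1.2 p.2).
  apply: (@within_continuous_comp _ _ _ [set p : R * R * R | p.1.1 \in `[0, T]]
    (fun p : R * R * R => (clamp 0 T p.1.1, p.1.2, p.2))
    (fun p : R * R * R => f p.1.1 p.1.2 p.2)) => // [p|p]; last first.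
    by rewrite /= in_itv/=.
  have c11 : continuous (fun q : R * R * R => clamp 0 T q.1.1).
    move=> q; apply: (@continuous_comp _ _ _ (fun q : R * R * R => q.1.1) (clamp 0 T)).
      by apply: (@continuous_comp _ _ _ fst fst); exact: cvg_fst.
    exact: continuous_clamp.
  have c12 : continuous (fun q : R * R * R => q.1.2).
    by move=> q; apply: (@continuous_comp _ _ _ fst snd); [exact: cvg_fst|exact: cvg_snd].
  exact: (cvg_pair (cvg_pair (c11 p) (c12 p)) cvg_snd).
pose m t := Num.max (- c (clamp 0 T t)) 0.
have m_cont : continuous m.
  move=> t; apply: (@continuous_max _ _ (fun t => - c (clamp 0 T t)) (fun=> 0)).
    apply: cvgN; apply: (@within_continuous_comp _ _ _ `[0, T] (clamp 0 T) c) => //.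
      exact: continuous_clamp.
  exact: cvg_cst.
have m_ge0 t : 0 <= m t by rewrite le_max lexx orbT.
have KE : K = tail T m 0.
  by apply: eq_Rintegral => t; rewrite inE/= in_itv/= => tT; rewrite /m clamp_id.
have K_ge0 : 0 <= K by apply: Rintegral_ge0 => t _; rewrite le_max lexx orbT.
have fluxE b w : continuous w -> nonlin_integral T f (prim T b w) = flux T F b w.
  move=> cw; have [_ dE] := prim_C1 (u := prim T b w) (b := b) T_gt0 cw (fun _ _ => erefl).
  apply: eq_Rintegral => t; rewrite inE/= => tI; rewrite dE//.
  by move: tI; rewrite in_itv/= /nemytskii => /FE ->.
have flux_ge b w : continuous w -> (forall t, 0 <= t <= T -> M2 <= w t) -> flux T F b w != 0.
  move=> cw wM; have [C1u dE] := prim_C1 (u := prim T b w) (b := b) T_gt0 cw (fun _ _ => erefl).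
  rewrite -fluxE//; apply: int_neq0_M2 => // t tI; rewrite dE//.
  by apply: wM; move: tI; rewrite in_itv.
have flux_le b w : continuous w -> (forall t, 0 <= t <= T -> w t <= M1) -> flux T F b w != 0.
  move=> cw wM; have [C1u dE] := prim_C1 (u := prim T b w) (b := b) T_gt0 cw (fun _ _ => erefl).
  rewrite -fluxE//; apply: int_neq0_M1 => // t tI; rewrite dE//.
  by apply: wM; move: tI; rewrite in_itv.
have convex_ge (x y s : R) : 0 <= s <= 1 -> M2 <= x -> M2 <= y -> M2 <= x + s * (y - x).
  by move=> /andP[s0 s1] xM yM; nra.
have convex_le (x y s : R) : 0 <= s <= 1 -> x <= M1 -> y <= M1 -> x + s * (y - x) <= M1.
  by move=> /andP[s0 s1] xM yM; nra.
have sign_ge := @flux_same_sign R T F [set x | M2 <= x] T_gt0 F_cont convex_ge flux_ge.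
have sign_le := @flux_same_sign R T F [set x | x <= M1] T_gt0 F_cont convex_le flux_le.
have M12r : `|M1| <= r /\ `|M2| <= r.
  have rE : r = Num.max `|phi_inv (L + 2 * K)| `|phi_inv (- (L + 2 * K))| by rewrite opprD.
  have K2 : L <= L + 2 * K by rewrite lerDl mulr_ge0.
  split; rewrite rE; apply: norm_le_max_phi_inv phi_homeo _; apply: le_trans K2.
    by rewrite le_max lexx orbT.
  by rewrite le_max lexx.
have [/andP[rM1 M1r] /andP[rM2 M2r]] : - r <= M1 <= r /\ - r <= M2 <= r.
  by rewrite -!ler_norml.
have r_gt0 : 0 < r by lra.
have rho_gt0 : 0 < rho by apply: lt_le_trans r_rho; rewrite mulr_gt0// addr_gt0.
(* As max(|1 - T|, 1) + 1 <= 2 + T, the condition on rho places [radius] above M2 and [- radius]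
   below M1. *)
have r_radius : r <= radius T rho.
  rewrite /radius ler_pdivlMr ?radius_den_gt0//; apply: le_trans r_rho.
  rewrite ler_pM2l// (_ : 2 + T = (1 + T) + 1); last by ring.
  rewrite lerD2r ge_max lerDl T_ge0 andbT ler_norml; apply/andP; split; lra.
(* The affine function a + b t has derivative b and terminal value a + b T. *)
pose h a b := flux T F (a + b * T) (cst b).
have h_cont : continuous (fun p : R * R => h p.1 p.2).
  move=> p; apply: cvg_flux => //.
  - by move=> q; exact: cst_continuous.
  - exact: cst_continuous.
  - exact: (cvgD cvg_fst (cvgM cvg_snd (cvg_cst T))).
  - move=> e e0; have /cvgrPdist_le/(_ e e0) : q.2 @[q --> p] --> p.2 by exact: cvg_snd.
    by apply: filterS => q + t _; rewrite distrC.
have GE : G_map T f = gmap T h.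
  apply/funext => v; rewrite /G_map /gmap /pt; apply/rowP => i; rewrite !mxE.
  case: ifP => // _; congr (_ - _ * _); apply: eq_Rintegral => t tI.
  rewrite /nemytskii -[_ + _ * t]/(affine v t) (@affine_prim R T v t tI) FE//.
  by move: tI; rewrite inE/= in_itv.
have h_le0 : h (radius T rho * (1 - T)) (radius T rho) *
    h (- radius T rho * (1 - T)) (- radius T rho) <= 0.
  rewrite leNgt; apply/negP => h_gt0; move/negP: deg_neq0; apply; apply/eqP.
  by rewrite GE; apply: brouwer_degree_eq0 => // v /G_neq0; rewrite GE.
have [_ [b1 b1P]] := thresholds K M1 phi_homeo.
have [[b2 b2P] _] := thresholds K M2 phi_homeo.
have [||b [w [cw flux0 wE]]] := @shooting_solution R T K F phi phi_inv T_gt0 K_ge0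
  F_cont phi_cont phi_inv_cont phi_invK b1 b2.
(* The flux of w1 <= M1 has the sign of h at [- radius], that of w2 >= M2 the sign of h at [radius],
   and these two values are not of the same strict sign. *)
- move=> w1 w2 cw1 cw2 w1P w2P.
  have h1 : 0 < flux T F b1 w1 * h (- radius T rho * (1 - T)) (- radius T rho).
    apply: sign_le => //; first exact: cst_continuous.
    - by move=> t _; rewrite /= -[w1 t]phiK; exact: b1P.
    - by move=> t _ /=; lra.
  have h2 : 0 < flux T F b2 w2 * h (radius T rho * (1 - T)) (radius T rho).
    apply: sign_ge => //; first exact: cst_continuous.
    - by move=> t _; rewrite /= -[w2 t]phiK; exact: b2P.
    - by move=> t _ /=; lra.
  move: h_le0 h1 h2; set x := h _ _; set y := h _ _; set p := flux _ _ _ _.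
  set q := flux _ _ _ _ => xy py qx; rewrite leNgt; apply/negP => pq.
  have := mulr_gt0 py qx; rewrite mulrACA (mulrC y) => pos.
  have := mulr_gt0 pq pos; rewrite mulrA -expr2; apply/negP; rewrite -leNgt.
  by rewrite mulr_ge0_le0// sqr_ge0.
(* The integrand is at least -c^-, so its integral over [t, T] is at least -K; since the total is 0,
   it is also minus the integral over [0, t], hence at most K. *)
- move=> b w cw flux0 t tT; have /andP[t0 tT'] := tT.
  have cN : continuous (nemytskii T F b w) by exact: continuous_nemytskii.
  have cNm : continuous (fun s => - m s) by move=> s; apply: cvgN; exact: m_cont.
  have Nm s : 0 <= s <= T -> - m s <= nemytskii T F b w s.
    move=> sT; rewrite /nemytskii FE// /m clamp_id// lerNl le_max.
    by rewrite lerN2 f_ge_c// in_itv.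
  have [/andP[_ i1] i2] := tail_nonneg_le m_cont m_ge0 tT.
  have j1 : - tail T m t <= tail T (nemytskii T F b w) t.
    rewrite /tail -RintegralN_itv//; apply: le_Rintegral_itv => // s /andP[ts sT].
    by apply: Nm; rewrite sT (le_trans t0).
  have j2 : - (\int[lebesgue_measure]_(s in `[0, t]) m s) <=
      \int[lebesgue_measure]_(s in `[0, t]) nemytskii T F b w s.
    rewrite -RintegralN_itv//; apply: le_Rintegral_itv => // s /andP[s0 st].
    by apply: Nm; rewrite s0 (le_trans st).
  move: flux0; rewrite /flux (tail_split cN t0 tT') => fl0.
  rewrite KE ler_norml; apply/andP; split; lra.
have wT : w T = b.
  by apply: (can_inj phiK); rewrite wE ?T_ge0 ?lexx// tail_ge// subr0.
have w0 : w 0 = b.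
  by apply: (can_inj phiK); rewrite wE ?T_ge0 ?lexx// -/(flux T F b w) flux0 subr0.
have [C1u dE] := prim_C1 (u := prim T b w) (b := b) T_gt0 cw (fun _ _ => erefl).
have cN : continuous (nemytskii T F b w) by exact: continuous_nemytskii.
(* On [0, T], phi(u') is the primitive of F(s, u, u') with value phi(b) at T, which yields the
   differential equation. *)
have [|C1v dvE] := prim_C1 (u := phi \o derive_on `[0, T] (prim T b w)) (b := phi b) T_gt0 cN.
  by move=> t; rewrite inE/= => tI; rewrite dE// wE//; move: tI; rewrite in_itv.
exists (prim T b w); split=> //.
- by move=> t tI; rewrite dvE// dE// /nemytskii FE//.
- by rewrite dE ?in_itv/= ?lexx// w0 /prim tail_ge// subr0.
- by rewrite !dE ?in_itv/= ?lexx ?T_ge0// w0 wT.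
Qed.
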